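(* For all $P_1,P_2,N>0$ and every $2\times2$ positive semidefinite $\mathsf K_W$, $$\mathcal C_{\mathrm{NoisyFBSI}}(P_1,P_2,N,\mathsf K_W)\supseteq\mathcal R_{\mathrm{SI}}(P_1,P_2,N,\mathsf K_W).$$
   Context: Channel model (noisy feedback with receiver side-information). Fix $P_1,P_2,N>0$ and a $2\times 2$ positive semidefinite matrix $\mathsf{K}_W=\begin{pmatrix}\sigma_1^2&\varrho\sigma_1\sigma_2\\ \varrho\sigma_1\sigma_2&\sigma_2^2\end{pmatrix}$. Messages $M_1,M_2$ are independent and uniform on finite sets $\mathcal{M}_1,\mathcal{M}_2$. $\{Z_t\}$ is IID $\mathcal{N}(0,N)$, $\{(W_{1,t},W_{2,t})\}$ is IID zero-mean bivariate Gaussian with covariance $\mathsf{K}_W$, all mutually independent and independent of the messages. The output is $Y_t=X_{1,t}+X_{2,t}+Z_t$, Transmitter $\nu$ observes causally $V_{\nu,t}=Y_t+W_{\nu,t}$ and uses encoders $X_{\nu,t}=\varphi_{\nu,t}(M_\nu,V_{\nu,1},\dots,V_{\nu,t-1})$ with $\frac1n\sum_t\mathbb E[X_{\nu,t}^2]\le P_\nu$. The decoder observes both the outputs and the feedback-noise sequences: $\phi:\mathbb R^n\times\mathbb R^n\times\mathbb R^n\to\mathcal M_1\times\mathcal M_2$, $(Y^n,W_1^n,W_2^n)\mapsto(\hat M_1,\hat M_2)$. $(R_1,R_2)$ is achievable if for every $\delta>0$ and all large $n$ there is a blocklength-$n$ code with $\frac1n\log|\mathcal M_\nu|>R_\nu-\delta$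 and error probability tending to $0$. $\mathcal C_{\mathrm{NoisyFBSI}}(P_1,P_2,N,\mathsf K_W)$ is the set of achievable pairs. Region $\mathcal R_{\mathrm{SI}}$. For a positive integer $\eta$, $\mathbf a_1,\mathbf a_2\in\mathbb R^\eta$, strictly lower-triangular $\mathsf B_1,\mathsf B_2\in\mathbb R^{\eta\times\eta}$ and $\mathsf C\in\mathbb R^{2\times\eta}$, let $\mathsf A=(\mathbf a_1\ \mathbf a_2)$. If $\mathsf C\mathsf C^{\mathsf T}$ is nonsingular, the region for these parameters is the set of nonnegative $(R_1,R_2)$ with $R_1\le\frac1{2\eta}\log\frac{\det(\mathsf C(\mathbf a_1\mathbf a_1^{\mathsf T}+N\mathsf I_\eta)\mathsf C^{\mathsf T})}{\det(N\mathsf C\mathsf C^{\mathsf T})}$, $R_2\le\frac1{2\eta}\log\frac{\det(\mathsf C(\mathbf a_2\mathbf a_2^{\mathsf T}+N\mathsf I_\eta)\mathsf C^{\mathsf T})}{\det(N\mathsf C\mathsf C^{\mathsf T})}$, $R_1+R_2\le\frac1{2\eta}\log\frac{\det(\mathsf C(\mathsf A\mathsf A^{\mathsf T}+N\mathsf I_\eta)\mathsf C^{\mathsf T})}{\det(N\mathsf C\mathsf C^{\mathsf T})}$; if $\mathsf C\mathsf C^{\mathsf T}$ is singular but $\mathsf C\ne0$, the same with $\mathsf C$ replaced by any nonzero row; if $\mathsf C=0$, $\{(0,0)\}$. Power constraints: let $\mathbb B=\begin{pmatrix}\mathsf B_1&\mathsf B_1\\ \mathsf B_2&\mathsf B_2\end{pmatrix}$,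 $\mathsf A_d=\begin{pmatrix}\mathbf a_1&\mathbf 0\\ \mathbf 0&\mathbf a_2\end{pmatrix}$, $\mathsf B_t=\begin{pmatrix}\mathsf B_1\\ \mathsf B_2\end{pmatrix}$, $\mathsf B_d=\begin{pmatrix}\mathsf B_1&0\\0&\mathsf B_2\end{pmatrix}$, $\mathsf K_W\otimes\mathsf I_\eta=\begin{pmatrix}\sigma_1^2\mathsf I_\eta&\varrho\sigma_1\sigma_2\mathsf I_\eta\\ \varrho\sigma_1\sigma_2\mathsf I_\eta&\sigma_2^2\mathsf I_\eta\end{pmatrix}$, $\Sigma=(\mathsf I_{2\eta}-\mathbb B)^{-1}(\mathsf A_d\mathsf A_d^{\mathsf T}+N\mathsf B_t\mathsf B_t^{\mathsf T}+\mathsf B_d(\mathsf K_W\otimes\mathsf I_\eta)\mathsf B_d^{\mathsf T})(\mathsf I_{2\eta}-\mathbb B)^{-\mathsf T}$; require the trace of the upper-left $\eta\times\eta$ block of $\Sigma$ to be $\le\eta P_1$ and of the lower-right block to be $\le\eta P_2$. $\mathcal R_{\mathrm{SI}}(P_1,P_2,N,\mathsf K_W)$ is the closure of the union of these regions over all $(\eta,\mathbf a_1,\mathbf a_2,\mathsf B_1,\mathsf B_2,\mathsf C)$ satisfying the power constraints. *)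

(* Defs.v *)
From HB Require Import structures.
From mathcomp Require Import all_boot all_order all_algebra.
From mathcomp Require Import all_classical all_reals all_analysis.
Set Implicit Arguments. Unset Strict Implicit. Unset Printing Implicit Defensive.
Import Order.TTheory GRing.Theory Num.Theory.
Import numFieldTopology.Exports.
Local Open Scope classical_set_scope.
Local Open Scope ring_scope.

Section NoisyFBSI.
Variable R : realType.

(* Noise at one time step: (Z_t, (W_{1,t}, W_{2,t})).                  *)
(* Z_t ~ N(0,N);  (W_1,W_2) ~ N(0,K_W) realised as                       *)
(*   W_1 = s1 G_1,  W_2 = s2 (rho G_1 + sqrt(1-rho^2) G_2),              *)
(* with G_1, G_2 IID N(0,1) independent of Z_t.                          *)
Definition noise_step_int (N s1 s2 rho : R) (f : R * (R * R) -> \bar R) : \bar R :=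
  (\int[normal_prob 0 (Num.sqrt N)]_z
     \int[normal_prob 0 1]_g1
       \int[normal_prob 0 1]_g2
         f (z, ((s1 * g1)%R, (s2 * (rho * g1 + Num.sqrt (1 - rho ^+ 2) * g2))%R)))%E.

(* Expectation of f over an IID length-n noise sequence (iterated      *)
(* integrals; time 0 is the head of the tuple).                          *)
Fixpoint noise_expect (N s1 s2 rho : R) (n : nat)
  : (n.-tuple (R * (R * R)) -> \bar R) -> \bar R :=
  match n return (n.-tuple (R * (R * R)) -> \bar R) -> \bar R with
  | 0 => fun f => f [tuple]
  | n'.+1 => fun f =>
      noise_step_int N s1 s2 rho
        (fun e => noise_expect N s1 s2 rho (fun s => f (cons_tuple e s)))
  end.

(* A blocklength-n code: message sets 'I_K1, 'I_K2 (nonempty finite),   *)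
(* causal encoders (at time t, the encoder receives its t past feedback  *)
(* outputs V_{nu,0..t-1}) and a decoder observing (Y^n, W_1^n, W_2^n).    *)
Record code (n : nat) := Code {
  K1 : nat;
  K2 : nat;
  K1_gt0 : (0 < K1)%N;
  K2_gt0 : (0 < K2)%N;
  enc1 : 'I_K1 -> nat -> seq R -> R;
  enc2 : 'I_K2 -> nat -> seq R -> R;
  dec : n.-tuple R -> n.-tuple R -> n.-tuple R -> 'I_K1 * 'I_K2;
  enc1_meas : forall m (t : nat),
      measurable_fun [set: t.-tuple R] (fun v : t.-tuple R => enc1 m t (tval v));
  enc2_meas : forall m (t : nat),
      measurable_fun [set: t.-tuple R] (fun v : t.-tuple R => enc2 m t (tval v));
  dec_meas : forall mm : 'I_K1 * 'I_K2,
      measurable [set y : n.-tuple R * (n.-tuple R * n.-tuple R) |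
                   dec y.1 y.2.1 y.2.2 = mm]
}.

Section run.
Variables (n : nat) (c : code n) (m1 : 'I_(K1 c)) (m2 : 'I_(K2 c)).
Variable e : nat -> R * (R * R). (* noise at time t: (Z_t, (W1_t, W2_t)) *)

Definition out_at (p : seq (R * R)) (t : nat) : R :=
  (nth (0, 0) p t).1 + (nth (0, 0) p t).2 + (e t).1.

Fixpoint inputs (k : nat) : seq (R * R) :=
  match k with
  | 0 => [::]
  | k'.+1 =>
      let p := inputs k' in
      rcons p
        (@enc1 n c m1 k' (mkseq (fun t => out_at p t + (e t).2.1) k'),
         @enc2 n c m2 k' (mkseq (fun t => out_at p t + (e t).2.2) k'))
  end.

Definition X1 (t : nat) : R := (nth (0, 0) (inputs n) t).1.
Definition X2 (t : nat) : R := (nth (0, 0) (inputs n) t).2.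
Definition Yseq : n.-tuple R := [tuple out_at (inputs n) (val t) | t < n].
Definition W1seq : n.-tuple R := [tuple (e (val t)).2.1 | t < n].
Definition W2seq : n.-tuple R := [tuple (e (val t)).2.2 | t < n].
Definition decoding_error : bool := @dec n c Yseq W1seq W2seq != (m1, m2).
End run.

Definition noise_fun (n : nat) (s : n.-tuple (R * (R * R))) : nat -> R * (R * R) :=
  fun t => nth (0, (0, 0)) s t.

Definition msg_avg n (c : code n) (F : 'I_(K1 c) -> 'I_(K2 c) -> \bar R) : \bar R :=
  (((K1 c)%:R * (K2 c)%:R)^-1%:E *
     \sum_(m1 < K1 c) \sum_(m2 < K2 c) F m1 m2)%E.

Definition err_prob (N s1 s2 rho : R) n (c : code n) : \bar R :=
  @msg_avg n c (fun m1 m2 => @noise_expect N s1 s2 rho n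
     (fun s => (@decoding_error n c m1 m2 (noise_fun s))%:R%:E)).

Definition power_ok (P1 P2 N s1 s2 rho : R) n (c : code n) : Prop :=
  ((n%:R^-1)%:E * \sum_(t < n) @msg_avg n c (fun m1 m2 => @noise_expect N s1 s2 rho n
      (fun s => (@X1 n c m1 m2 (noise_fun s) t ^+ 2)%:E)) <= P1%:E)%E /\
  ((n%:R^-1)%:E * \sum_(t < n) @msg_avg n c (fun m1 m2 => @noise_expect N s1 s2 rho n
      (fun s => (@X2 n c m1 m2 (noise_fun s) t ^+ 2)%:E)) <= P2%:E)%E.

Definition achievable (P1 P2 N s1 s2 rho : R) (R1 R2 : R) : Prop :=
  forall delta : R, 0 < delta ->
  exists (n0 : nat) (cs : forall n : nat, code n),
    (forall n : nat, (n0 <= n)%N ->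
       [/\ power_ok P1 P2 N s1 s2 rho (cs n),
           R1 - delta < n%:R^-1 * ln (K1 (cs n))%:R &
           R2 - delta < n%:R^-1 * ln (K2 (cs n))%:R]) /\
    (forall eps : R, 0 < eps -> exists N0 : nat, forall n : nat, (N0 <= n)%N ->
       (err_prob N s1 s2 rho (cs n) <= eps%:E)%E).

Definition C_NoisyFBSI (P1 P2 N s1 s2 rho : R) : set (R * R) :=
  [set r | achievable P1 P2 N s1 s2 rho r.1 r.2].

Definition rate_bound (N : R) (eta k : nat) (D : 'M[R]_(k, eta)) (S : 'M[R]_eta) : R :=
  (2 * eta%:R)^-1 *
    ln (\det (D *m (S + N%:M) *m D^T) / \det (N *: (D *m D^T))).

Definition region_D (N : R) (eta k : nat) (a1 a2 : 'cV[R]_eta) (D : 'M[R]_(k, eta))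
  : set (R * R) :=
  [set r | [/\ 0 <= r.1, 0 <= r.2,
     r.1 <= rate_bound N D (a1 *m a1^T),
     r.2 <= rate_bound N D (a2 *m a2^T) &
     r.1 + r.2 <= rate_bound N D (row_mx a1 a2 *m (row_mx a1 a2)^T)]].

Definition region_params (N : R) (eta : nat) (a1 a2 : 'cV[R]_eta)
  (C : 'M[R]_(2, eta)) : set (R * R) :=
  if C == 0 then [set (0, 0)]
  else if \det (C *m C^T) != 0 then region_D N a1 a2 C
  else
    [set r | exists i : 'I_2, row i C != 0 /\ region_D N a1 a2 (row i C) r].

Definition strictly_lower (eta : nat) (B : 'M[R]_eta) : Prop :=
  forall i j : 'I_eta, (i <= j)%N -> B i j = 0.

Definition SigmaSI (N s1 s2 rho : R) (eta : nat) (a1 a2 : 'cV[R]_eta)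
  (B1 B2 : 'M[R]_eta) : 'M[R]_(eta + eta) :=
  let BB : 'M[R]_(eta + eta) := block_mx B1 B1 B2 B2 in
  let Ad : 'M[R]_(eta + eta, 1 + 1) := block_mx a1 0 0 a2 in
  let Bt : 'M[R]_(eta + eta, eta) := col_mx B1 B2 in
  let Bd : 'M[R]_(eta + eta) := block_mx B1 0 0 B2 in
  let KW : 'M[R]_(eta + eta) :=
    block_mx (s1 ^+ 2)%:M (rho * s1 * s2)%:M (rho * s1 * s2)%:M (s2 ^+ 2)%:M in
  let Inv := invmx (1%:M - BB) in
  Inv *m (Ad *m Ad^T + N *: (Bt *m Bt^T) + Bd *m KW *m Bd^T) *m Inv^T.

Definition power_params (P1 P2 N s1 s2 rho : R) (eta : nat) (a1 a2 : 'cV[R]_eta)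
  (B1 B2 : 'M[R]_eta) : Prop :=
  let S := SigmaSI N s1 s2 rho a1 a2 B1 B2 in
  \tr (ulsubmx S) <= eta%:R * P1 /\ \tr (drsubmx S) <= eta%:R * P2.

Definition R_SI (P1 P2 N s1 s2 rho : R) : set (R * R) :=
  closure [set r | exists (eta : nat) (a1 a2 : 'cV[R]_eta) (B1 B2 : 'M[R]_eta)
                          (C : 'M[R]_(2, eta)),
     [/\ (0 < eta)%N, strictly_lower B1, strictly_lower B2,
         power_params P1 P2 N s1 s2 rho a1 a2 B1 B2 &
         region_params N a1 a2 C r]].

End NoisyFBSI.

(* Main.v *)
Require Import Defs.
From HB Require Import structures.
From mathcomp Require Import all_boot all_order all_algebra.
From mathcomp Require Import all_classical all_reals all_analysis.
From mathcomp Require Import measurable_realfun zify ring lra.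
Import Defs.
Set Implicit Arguments. Unset Strict Implicit. Unset Printing Implicit Defensive.
Import Order.TTheory GRing.Theory Num.Theory.
Import numFieldTopology.Exports.
Local Open Scope classical_set_scope.
Local Open Scope ring_scope.

(** Because the receiver knows the feedback noises, it can remove the feedback
    part of the inputs: each block of [eta] channel uses then becomes the
    memoryless Gaussian channel [a1 xi1 + a2 xi2 + Z].  The symbols [xi1], [xi2]
    are superpositions of many binary layers of small signal-to-noise ratio [vs],
    decoded one after the other by correlating the output of an MMSE filter with
    the codewords.  A layer carries almost [vs / (2 (1 + vs))], and these
    quantities telescope to half the logarithm of a ratio of covariance
    determinants; interleaving the layers of the two users reaches every point
    of the dominant face.  Random sign codebooks are subgaussian with the variance
    of the Gaussian they replace, so moment generating functions suffice for the
    error probability, and closing every codebook under negation makes the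
    powers exact. *)

(** A layer of signal-to-noise ratio [vs] could ideally carry ln (1 + vs) / 2, whereas thresholding
    a correlation gives only vs / (2 (1 + vs)): the score of a false codeword is disturbed by the
    true layer as well, so its variance proxy is vs + vs^2 instead of vs. The loss is of second
    order in [vs] while the number of layers is of order 1 / vs, so the total loss vanishes with
    [vs]; this is why the layers have to be weak. In exchange, the error analysis is a Chernoff
    bound: the sums over codebooks and the noise integrals involve only exponentials that can be
    evaluated or bounded explicitly. Under the iterated integrals the error indicator is only ever
    bounded pointwise by such exponentials, so monotonicity for nonnegative functions takes the
    place of measurability and Fubini. As the power bound holds for every codebook, the averaging
    argument has only the error probability to control. *)

(** * Elementary bounds on exp and cosh *)

Section ExponentialInequalities.
Import numFieldNormedType.Exports.
Variable R : realType.

(** From [expR (- x) >= 1 - x]: the product of [1 - x] with the right-hand side is 1 + x^2 (1 - 2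
    x), which is at least 1 for [x <= 1 / 2]. *)
Lemma expR_le_quad (x : R) : x <= 1 / 2 -> expR x <= 1 + x + 2 * x ^+ 2.
Proof.
move=> x1; have y0 : 0 < 1 - x by lra.
have -> : expR x = (expR (- x))^-1 by rewrite expRN invrK.
rewrite -[leLHS]div1r ler_pdivrMr ?expR_gt0//.
have := expR_ge1Dx (- x); set e := expR (- x) => le_e.
have : 0 <= 1 + x + 2 * x ^+ 2 by nra.
nra.
Qed.

Lemma cosh_ge1 (x : R) : 2 <= expR x + expR (- x).
Proof. by have := expR_ge1Dx x; have := expR_ge1Dx (- x); lra. Qed.

Lemma le_cont_deriv (f df : R -> R) (a b : R) : a <= b ->
  (forall x : R, is_derive x (1 : R) f (df x)) -> (forall x, a <= x -> 0 <= df x) ->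
  f a <= f b.
Proof.
move=> ab fd df0.
have [|c + fE] := @MVT_segment R f df a b ab (fun x _ => fd x).
  apply: continuous_subspaceT => x; apply: differentiable_continuous.
  by apply/derivable1_diffP; case: (fd x).
rewrite in_itv/= => /andP[ac _].
by rewrite -subr_ge0 fE mulr_ge0 ?subr_ge0// df0.
Qed.

Lemma sinh_ge (x : R) : 0 <= x -> 2 * x <= expR x - expR (- x).
Proof.
move=> x0.
pose f (x : R) := expR x - expR (- x) - 2 * x.
pose df (x : R) := expR x + expR (- x) - 2.
have := @le_cont_deriv f df 0 x x0.
rewrite /f /= oppr0 mulr0 subrr subr0 subr_ge0; apply.
  move=> y; apply: is_derive_eq; rewrite /df.
  by rewrite /GRing.scale /=; ring.
by move=> y _; rewrite subr_ge0 cosh_ge1.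
Qed.

(** The identity cosh x - 1 = 2 sinh (x / 2)^2 reduces this to sinh y >= y. *)
Lemma cosh_ge (x : R) : 1 + x ^+ 2 / 2 <= (expR x + expR (- x)) / 2.
Proof.
wlog x0 : x / 0 <= x.
  move=> H; have [/H//|/ltW] := leP 0 x.
  by rewrite -oppr_ge0 => /H; rewrite sqrrN opprK [X in _ <= X / _]addrC.
have := @sinh_ge (x / 2) (divr_ge0 x0 (ler0n _ _)).
have E0 := expR_ge0 (x / 2); have E1 := expR_ge0 (- (x / 2)).
have E : expR (x / 2) * expR (- (x / 2)) = 1 by rewrite expRxMexpNx_1.
have -> : expR x = expR (x / 2) ^+ 2 by rewrite -expRM_natr; congr expR; field.
have -> : expR (- x) = expR (- (x / 2)) ^+ 2.
  by rewrite -expRM_natr; congr expR; field.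
set A := expR (x / 2) in E E0 *; set B := expR (- (x / 2)) in E E1 *.
by move=> H; nra.
Qed.

(** A fair sign is subgaussian with variance proxy 1. On [0 <= x] the function [h], which is -2 cosh
    x exp (- x^2 / 2), is nondecreasing: its derivative has the sign of [k], that is of x cosh x -
    sinh x. *)
Lemma cosh_le (x : R) : (expR x + expR (- x)) / 2 <= expR (x ^+ 2 / 2).
Proof.
wlog x0 : x / 0 <= x.
  move=> H; have [/H//|/ltW] := leP 0 x.
  by rewrite -oppr_ge0 => /H; rewrite sqrrN opprK [X in X / _ <= _]addrC.
pose k (x : R) := (1 + x) * expR (- x) - (1 - x) * expR x.
have k0 y : 0 <= y -> 0 <= k y.
  move=> y0; pose dk (x : R) := x * (expR x - expR (- x)).
  have := @le_cont_deriv k dk 0 y y0.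
  rewrite (_ : k 0 = 0); last by rewrite /k oppr0 expR0; ring.
  apply.
    move=> z; apply: is_derive_eq; rewrite /dk.
    by rewrite /GRing.scale /=; ring.
  move=> z z0; rewrite mulr_ge0// subr_ge0 ler_expR; lra.
pose h (x : R) := - (expR (x - x ^+ 2 / 2) + expR (- x - x ^+ 2 / 2)).
pose dh (x : R) := expR (- (x ^+ 2 / 2)) * k x.
have dP (z : R) : is_derive z (1 : R) h (dh z).
  apply: is_derive_eq; rewrite /dh /k !(expRD, expRB).
  by rewrite /GRing.scale /=; field.
have : h 0 <= h x.
  apply: (@le_cont_deriv h dh 0 x x0 dP) => z z0.
  by rewrite /dh mulr_ge0 ?expR_ge0 ?k0.
rewrite /h oppr0 expr0n/= mul0r subr0 expR0 lerN2 !expRD (expRN (x ^+ 2 / 2)).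
by rewrite -mulrDl ler_pdivrMr ?expR_gt0// ler_pdivrMr// => H; lra.
Qed.

End ExponentialInequalities.

(** * Gaussian integrals of exponentials *)

Section GaussianExponentials.
Variable R : realType.
Notation mu := (@lebesgue_measure R).

Lemma ge0_integral_normal_prob (m s : R) (f : R -> \bar R) :
  measurable_fun setT f -> (forall x, (0 <= f x)%E) ->
  (\int[normal_prob m s]_x f x =
   \int[mu]_x (f x * (normal_pdf m s x)%:E))%E.
Proof.
move=> mf f0.
have dom := @normal_prob_dominates R m s.
rewrite -(Radon_Nikodym_SigmaFinite.change_of_variables dom)//=.
have mg : measurable_fun setT
    (Radon_Nikodym_SigmaFinite.f (normal_prob m s) mu).
  exact: measurable_int (Radon_Nikodym_SigmaFinite.f_integrable dom).
have mp : measurable_fun setT (fun x => (normal_pdf m s x)%:E).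
  by apply/measurable_EFinP; exact: measurable_normal_pdf.
apply: ae_eq_integral => //=; [exact: emeasurable_funM|exact: emeasurable_funM|].
(* The abstract Radon-Nikodym derivative and [normal_pdf] have the same integral over every
   measurable set, hence agree almost everywhere. *)
apply: ae_eqe_mul2l; apply: integral_ae_eq => //=.
  exact: Radon_Nikodym_SigmaFinite.f_integrable.
by move=> E _ mE; rewrite -Radon_Nikodym_SigmaFinite.f_integral.
Qed.

(** Completing the square: the tilted density is a multiple of the normal density of mean
    [a * s ^+ 2]. *)
Lemma normal_mgf (s a : R) : s != 0 ->
  (\int[normal_prob 0 s]_x (expR (a * x))%:E = (expR (s ^+ 2 * a ^+ 2 / 2))%:E)%E.
Proof.
move=> s0; rewrite ge0_integral_normal_prob; last 2 first.
- by apply/measurable_EFinP; apply: measurableT_comp => //; exact: mulrl_measurable.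
- by move=> x; rewrite lee_fin expR_ge0.
transitivity (\int[mu]_x ((expR (s ^+ 2 * a ^+ 2 / 2))%:E *
    (normal_pdf (a * s ^+ 2) s x)%:E))%E; last first.
  rewrite integralZl//=; last exact: integrable_normal_pdf.
  by rewrite integral_normal_pdf mule1.
apply: eq_integral => x _; rewrite -!EFinM; congr EFin.
rewrite !normal_pdfE// !(mulrCA _ (normal_peak s)); congr (_ * _).
rewrite /normal_fun -!expRD; congr expR.
by field; rewrite s0.
Qed.

Lemma integral_sum_expR (s : R) I (r : seq I) (c a : I -> R) : s != 0 ->
  (\int[normal_prob 0 s]_x (\sum_(i <- r) c i * expR (a i * x))%:E =
  (\sum_(i <- r) c i * expR (s ^+ 2 * a i ^+ 2 / 2))%:E)%E.
Proof.
move=> s0; have int i : (normal_prob 0 s).-integrable setT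
    (fun x : R => (expR (a i * x))%:E).
  apply/integrableP; split.
    by apply/measurable_EFinP; apply: measurableT_comp => //; exact: mulrl_measurable.
  under eq_integral do rewrite gee0_abs ?lee_fin ?expR_ge0//.
  by rewrite normal_mgf// ltry.
under eq_integral do rewrite -sumEFin.
rewrite integral_sum//=; last first.
  by move=> i; under eq_fun do rewrite EFinM; exact: integrableZl.
rewrite -sumEFin; apply: eq_bigr => i _.
under eq_integral do rewrite EFinM.
by rewrite integralZl//= normal_mgf// EFinM.
Qed.

(** The integral of a nonnegative function is a supremum over the simple functions below it, which
    is monotone even for nonmeasurable integrands. The error indicator and the squared inputs are
    handled through this alone. *)
Lemma le_integral_ge0 d (T : measurableType d) (P : {measure set T -> \bar R})
    (f g : T -> \bar R) :
  (forall x, 0 <= f x)%E -> (forall x, f x <= g x)%E ->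
  (\int[P]_x f x <= \int[P]_x g x)%E.
Proof.
move=> f0 fg; have g0 x : (0 <= g x)%E by exact: le_trans (f0 x) (fg x).
rewrite !ge0_integralTE//; apply: le_ereal_sup => _ [h hf <-].
by exists h => // x; exact: le_trans (hf x) (fg x).
Qed.

End GaussianExponentials.

(** * Moment generating functions of the noise sequence *)

Section NoiseExpectation.
Variable R : realType.
Variables (N s1 s2 rho : R).
Implicit Types (n : nat) (p e : R * (R * R)).

Lemma noise_step_int_ge0 (f : R * (R * R) -> \bar R) :
  (forall x, 0 <= f x)%E -> (0 <= noise_step_int N s1 s2 rho f)%E.
Proof. by move=> f0; do 3 (apply: integral_ge0 => ? _). Qed.

Lemma le_noise_step_int (f g : R * (R * R) -> \bar R) :
  (forall x, 0 <= f x)%E -> (forall x, f x <= g x)%E ->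
  (noise_step_int N s1 s2 rho f <= noise_step_int N s1 s2 rho g)%E.
Proof.
move=> f0 fg; apply: le_integral_ge0 => z.
  by do 2 (apply: integral_ge0 => ? _).
apply: le_integral_ge0 => g1; first by apply: integral_ge0.
exact: le_integral_ge0.
Qed.

Lemma noise_expect_ge0 n (f : n.-tuple (R * (R * R)) -> \bar R) :
  (forall x, 0 <= f x)%E -> (0 <= noise_expect N s1 s2 rho f)%E.
Proof.
elim: n f => [|n IH] f f0; first exact: f0.
by apply: noise_step_int_ge0 => x; apply: IH => s.
Qed.

Lemma le_noise_expect n (f g : n.-tuple (R * (R * R)) -> \bar R) :
  (forall x, 0 <= f x)%E -> (forall x, f x <= g x)%E ->
  (noise_expect N s1 s2 rho f <= noise_expect N s1 s2 rho g)%E.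
Proof.
elim: n f g => [|n IH] f g f0 fg; first exact: fg.
apply: le_noise_step_int => x; first exact: noise_expect_ge0.
exact: IH.
Qed.

Definition noise_form p e : R := p.1 * e.1 + p.2.1 * e.2.1 + p.2.2 * e.2.2.

(** The variance of [noise_form p] when [Z] has variance [N] and the independent pair (W1, W2) has
    covariance K_W. *)
Definition noise_var p : R :=
  N * p.1 ^+ 2 + s1 ^+ 2 * p.2.1 ^+ 2 + 2 * rho * s1 * s2 * p.2.1 * p.2.2
  + s2 ^+ 2 * p.2.2 ^+ 2.

Hypothesis N_gt0 : 0 < N.
Hypothesis rho1 : -1 <= rho <= 1.

(** Each of the three integrations maps sums of exponentials of linear forms, with coefficients of
    any sign, to sums of the same kind; this closure drives the induction over time. *)
Lemma noise_step_int_exp I (r : seq I) (c : I -> R) (p : I -> R * (R * R)) :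
  noise_step_int N s1 s2 rho
    (fun e => (\sum_(i <- r) c i * expR (noise_form (p i) e))%:E) =
  (\sum_(i <- r) c i * expR (noise_var (p i) / 2))%:E.
Proof.
have sN : Num.sqrt N != 0 by rewrite gt_eqF ?sqrtr_gt0.
have one0 : 1 != 0 :> R by exact: oner_neq0.
set q := Num.sqrt (1 - rho ^+ 2).
have q2 : q ^+ 2 = 1 - rho ^+ 2 by rewrite sqr_sqrtr//; case/andP: rho1 => ? ?; nra.
rewrite /noise_step_int.
under eq_integral => z _.
  under eq_integral => g1 _.
    under eq_integral => g2 _.
      under eq_bigr => i _.
        rewrite /noise_form /= -/q.
        rewrite [X in expR X](_ : _ = ((p i).1 * z + ((p i).2.1 * s1 + (p i).2.2 * s2 * rho) * g1)
          + (p i).2.2 * s2 * q * g2); last by ring.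
        rewrite expRD mulrA.
        over.
      over.
    rewrite (integral_sum_expR _ _ _ one0).
    under eq_bigr => i _.
      rewrite -mulrA -expRD [X in expR X](_ : _ = (p i).1 * z + 1 ^+ 2 * ((p i).2.2 * s2 * q) ^+ 2 / 2 +
         ((p i).2.1 * s1 + (p i).2.2 * s2 * rho) * g1); last by ring.
      rewrite expRD mulrA.
      over.
    over.
  rewrite (integral_sum_expR _ _ _ one0).
  under eq_bigr => i _.
    rewrite -mulrA -expRD [X in expR X](_ : _ = (1 ^+ 2 * ((p i).2.2 * s2 * q) ^+ 2 / 2 +
         1 ^+ 2 * ((p i).2.1 * s1 + (p i).2.2 * s2 * rho) ^+ 2 / 2) + (p i).1 * z); last by ring.
    rewrite expRD mulrA.
    over.
  over.
rewrite (integral_sum_expR _ _ _ sN); congr EFin; apply: eq_bigr => i _.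
rewrite -mulrA -expRD; congr (_ * expR _).
rewrite sqr_sqrtr ?ltW// !exprMn q2 /noise_var.
by field.
Qed.

Lemma noise_expect_exp n I (r : seq I) (c : I -> R) (p : I -> nat -> R * (R * R)) :
  noise_expect N s1 s2 rho (fun s : n.-tuple (R * (R * R)) =>
    (\sum_(i <- r) c i * expR (\sum_(t < n) noise_form (p i t) (noise_fun s t)))%:E)
  = (\sum_(i <- r) c i * expR ((\sum_(t < n) noise_var (p i t)) / 2))%:E.
Proof.
elim: n c p => [|n IH] c p /=.
  by under eq_bigr do rewrite big_ord0; under [in RHS]eq_bigr do rewrite big_ord0 mul0r.
under (@eq_fun _ _ _ _) => e.
  under (@eq_fun _ _ _ _) => s.
    under eq_bigr => i _.
      rewrite big_ord_recl expRD mulrA.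
      under eq_bigr => t _ do rewrite (_ : noise_form _ _ =
        noise_form (p i t.+1) (noise_fun s t)) //.
      over.
    over.
  (* The noise at time 0 is frozen into the coefficients, which is why they are arbitrary in the
     statement. *)
  rewrite (IH (fun i => c i * expR (noise_form (p i 0%N) e)) (fun i t => p i t.+1)).
  under eq_bigr => i _ do rewrite mulrAC.
  over.
rewrite noise_step_int_exp; congr EFin; apply: eq_bigr => i _.
rewrite -mulrA -expRD; congr (_ * expR _).
by rewrite big_ord_recl [RHS]mulrDl [LHS]addrC.
Qed.

(* The even part of [expR (l * x)] is at least [1 + (l * x)^2 / 2], so letting
   [l] tend to [0] the moment generating function bounds the second moment. *)
Lemma noise_expect_sqr_le n (m : R) (p : nat -> R * (R * R)) :
  (noise_expect N s1 s2 rho (fun s : n.-tuple (R * (R * R)) =>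
    ((m + \sum_(t < n) noise_form (p t) (noise_fun s t)) ^+ 2)%:E)
  <= (m ^+ 2 + \sum_(t < n) noise_var (p t))%:E)%E.
Proof.
set V := \sum_(t < n) noise_var (p t); set E := noise_expect _ _ _ _ _.
suff bnd l : 0 < l -> (E <= (2 / l ^+ 2 * (expR (l ^+ 2 * (m ^+ 2 + V) / 2) - 1))%:E)%E.
  set v := m ^+ 2 + V in bnd *.
  apply/lee_addgt0Pr => e e0.
  (* With [l ^+ 2 = d], the bound is at most v + d v^2 by [expR_le_quad]. So [d] must make d v^2 at
     most [e] and d v / 2 at most 1 / 2. *)
  pose k := Num.min 1 (e / (1 + v ^+ 2)).
  have v2 : 0 <= v ^+ 2 := sqr_ge0 v.
  have k0 : 0 < k by rewrite lt_min ltr01 divr_gt0//; lra.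
  have ke : k * (1 + v ^+ 2) <= e.
    by rewrite -ler_pdivlMr ?ge_min ?lexx ?orbT//; lra.
  have k1 : k <= 1 by rewrite ge_min lexx.
  pose d := Num.min k (1 + `|v|)^-1.
  have av : 0 <= `|v| by [].
  have d0 : 0 < d by rewrite lt_min k0 invr_gt0; lra.
  have dk : d <= k by rewrite ge_min lexx.
  have dv : d * `|v| <= 1.
    have : d * (1 + `|v|) <= 1.
      by rewrite -ler_pdivlMr ?mul1r ?ge_min ?lexx ?orbT//; lra.
    by lra.
  have /bnd : 0 < Num.sqrt d by rewrite sqrtr_gt0.
  rewrite (sqr_sqrtr (ltW d0)) => H; apply: (le_trans H).
  rewrite -EFinD lee_fin.
  have x2 : d * v / 2 <= 1 / 2.
    by have := ler_wpM2l (ltW d0) (ler_norm v); lra.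
  have q := expR_le_quad x2.
  rewrite mulrAC ler_pdivrMr//.
  have : d * v ^+ 2 <= e by nra.
  by nra.
move=> l0.
(* Weights of the second difference with step [l], at 0, of the map sending [a] to exp (a (m +
   x)). *)
pose c (a : R) := (if a == 0 then -2 else 1) / l ^+ 2 * expR (a * m).
pose q (a : R) (t : nat) := (a * (p t).1, (a * (p t).2.1, a * (p t).2.2)).
have qE a (s : n.-tuple (R * (R * R))) :
    \sum_(t < n) noise_form (q a t) (noise_fun s t) =
    a * \sum_(t < n) noise_form (p t) (noise_fun s t).
  by rewrite mulr_sumr; apply: eq_bigr => t _; rewrite /q /noise_form /=; ring.
have qV a : \sum_(t < n) noise_var (q a t) = a ^+ 2 * \sum_(t < n) noise_var (p t).
  by rewrite mulr_sumr; apply: eq_bigr => t _; rewrite /q /noise_var /=; ring.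
have l2 : 0 < l ^+ 2 by rewrite exprn_gt0.
have lN : (- l == 0) = false by apply/eqP; lra.
apply: (@le_trans _ _ (noise_expect N s1 s2 rho (fun s : n.-tuple (R * (R * R)) =>
    (\sum_(i <- [:: l; -l; 0]) c i *
       expR (\sum_(t < n) noise_form (q i t) (noise_fun s t)))%:E))).
  apply: le_noise_expect => s; first by rewrite lee_fin sqr_ge0.
  rewrite lee_fin !big_cons big_nil addr0 /c eqxx lN (gt_eqF l0).
  rewrite !qE !mul0r expR0 !mulr1.
  set x := \sum_(t < n) _.
  have := cosh_ge (l * (m + x)).
  rewrite mulrDr opprD !expRD -!mulNr.
  set A := expR (l * m); set B := expR (l * x).
  set A' := expR (- l * m); set B' := expR (- l * x) => H.
  rewrite (_ : (m + x) ^+ 2 = 2 / l ^+ 2 * ((l * (m + x)) ^+ 2 / 2)); last first.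
    by field; rewrite gt_eqF.
  rewrite [leRHS](_ : _ = 2 / l ^+ 2 * ((A * B + A' * B') / 2 - 1)); last by field; rewrite gt_eqF.
  by rewrite mulrDr ler_wpM2l ?divr_ge0 ?(ltW l2)//; lra.
rewrite noise_expect_exp lee_fin !big_cons big_nil addr0 /c eqxx lN (gt_eqF l0).
rewrite !qV -/V sqrrN expr0n/= !mul0r expR0 !mulr1 mulNr.
rewrite [leLHS](_ : _ = 2 / l ^+ 2 * ((expR (l * m) + expR (- (l * m))) / 2 *
  expR (l ^+ 2 * V / 2) - 1)); last first.
  by rewrite [- l * m]mulNr; field; rewrite gt_eqF.
rewrite ler_wpM2l ?divr_ge0 ?(ltW l2)// lerB//.
rewrite mulrDr mulrDl expRD ler_wpM2r ?expR_ge0//.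
by apply: le_trans (cosh_le _) _; rewrite exprMn.
Qed.

End NoiseExpectation.

(** * Random sign codebooks *)

Section RandomSigns.
Variable R : realType.
Variables (I : finType) (k : nat).
Implicit Types (p q : I) (cb : {ffun I * 'I_k -> bool}).

Definition sgb (b : bool) : R := (-1) ^+ b.

Lemma sgb_addb a b : sgb (a (+) b) = sgb a * sgb b.
Proof. by rewrite /sgb signr_addb. Qed.

Lemma sgb_sqr a : sgb a * sgb a = 1.
Proof. by case: a; rewrite /sgb ?expr0 ?expr1; ring. Qed.

Lemma sum_prod_signs (w : I -> R) :
  \sum_(cb : {ffun I * 'I_k -> bool}) expR (\sum_(t < k) \sum_q w q * sgb (cb (q, t))) =
  \prod_(i : I * 'I_k) (expR (w i.1) + expR (- w i.1)).
Proof.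
have E (i : I * 'I_k) :
    expR (w i.1) + expR (- w i.1) = \sum_(b : bool) expR (w i.1 * sgb b).
  by rewrite big_bool /sgb expr1 expr0 mulr1 mulrN1 addrC.
under [RHS]eq_bigr do rewrite E.
rewrite bigA_distr_bigA; apply: eq_bigr => cb _.
rewrite exchange_big pair_big/= expR_sum; apply: eq_bigr => -[q t] _ //.
Qed.

(* Multiplying every other coordinate by the sign at [p] is an involution of
   the codebooks, which removes the factor [sgb (cb (p, t))]. *)
Lemma sum_correlation_le p (w : I -> R) : w p = 0 ->
  \sum_(cb : {ffun I * 'I_k -> bool}) expR (\sum_(t < k) sgb (cb (p, t)) * \sum_q w q * sgb (cb (q, t))) <=
  #|{ffun I * 'I_k -> bool}|%:R * expR (k%:R * (\sum_q w q ^+ 2) / 2).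
Proof.
move=> wp.
pose f cb : {ffun I * 'I_k -> bool} :=
  [ffun i => cb i (+) ((i.1 != p) && cb (p, i.2))].
have fK : involutive f.
  move=> cb; apply/ffunP => -[q t]; rewrite !ffunE /= eqxx /= addbF.
  by rewrite -addbA addbb addbF.
rewrite (reindex_inj (inv_inj fK)) /=.
under eq_bigr => cb _.
  rewrite (_ : \sum_(t < k) _ = \sum_(t < k) \sum_q w q * sgb (cb (q, t))); last first.
    apply: eq_bigr => t _; rewrite mulr_sumr; apply: eq_bigr => q _.
    rewrite !ffunE /= eqxx /= addbF; have [->|qp] := eqVneq q p.
      by rewrite wp !mul0r mulr0.
    by rewrite /= sgb_addb mulrCA [X in _ * X]mulrCA sgb_sqr mulr1.
  over.
rewrite sum_prod_signs card_ffun card_bool card_prod card_ord natrX.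
apply: (@le_trans _ _ (\prod_(i : I * 'I_k) (2 * expR (w i.1 ^+ 2 / 2)))).
  apply: ler_prod => i _; apply/andP; split.
    by rewrite addr_ge0 ?expR_ge0.
  by have := cosh_le (w i.1); rewrite ler_pdivrMr// mulrC.
rewrite big_split/= prodr_const card_prod card_ord -expR_sum.
rewrite -(pair_big xpredT xpredT (fun q (t : 'I_k) => w q ^+ 2 / 2)) /=.
rewrite (_ : \sum_i _ = k%:R * (\sum_q w q ^+ 2) / 2)// mulr_sumr mulr_suml.
by apply: eq_bigr => q _; rewrite sumr_const card_ord -mulrA mulr_natl.
Qed.

End RandomSigns.

(** * Unfolding the causal channel recursion *)

Section ChannelRun.
Variables (R : realType) (n : nat) (c : code R n) (m1 : 'I_(K1 c)) (m2 : 'I_(K2 c)).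
Variable e : nat -> R * (R * R).

Let inp := @inputs R n c m1 m2 e.

Lemma size_inputs k : size (inp k) = k.
Proof. by elim: k => //= k IH; rewrite /inp /= size_rcons -/inp IH. Qed.

Lemma nth_inputs k t : (t < k)%N -> nth (0, 0) (inp k) t = nth (0, 0) (inp t.+1) t.
Proof.
elim: k => // k IH; rewrite ltnS leq_eqVlt => /predU1P[->//|tk].
by rewrite -IH// /inp /= nth_rcons size_inputs tk.
Qed.

Definition Yat (t : nat) : R := X1 m1 m2 e t + X2 m1 m2 e t + (e t).1.

(** [inputs] recomputes the outputs from a prefix at every step. Inputs once written never change,
    so the encoders see the actual outputs. *)
Lemma X_rec (t : nat) : (t < n)%N ->
  X1 m1 m2 e t = enc1 m1 t (mkseq (fun s => Yat s + (e s).2.1) t) /\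
  X2 m1 m2 e t = enc2 m2 t (mkseq (fun s => Yat s + (e s).2.2) t).
Proof.
move=> tn; rewrite /X1 /X2 -/inp nth_inputs// /inp /= nth_rcons size_inputs ltnn eqxx /=.
have E f : mkseq (fun s => @out_at R e (inp t) s + f s) t =
           mkseq (fun s => Yat s + f s) t.
  apply/eq_in_map => s; rewrite mem_iota add0n => /andP[_ st].
  rewrite /Yat /X1 /X2 /out_at -/inp.
  by rewrite (nth_inputs st) (nth_inputs (ltn_trans st tn)).
by rewrite -!(E (fun s => _)).
Qed.

Lemma tnth_Yseq (t : 'I_n) : tnth (Yseq m1 m2 e) t = Yat t.
Proof. by rewrite tnth_mktuple. Qed.

End ChannelRun.

(** * Measurability of decisions based on finitely many tests *)

Section FiniteMeasurability.
Variables (d : measure_display) (T : measurableType d) (I : finType) (P : I -> T -> bool).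
Hypothesis mP : forall i, measurable [set y | P i y].

(** A preimage is a finite union, over tables of answers, of finite intersections of the tests or
    their complements. *)
Lemma measurable_boolfun (U : Type) (g : {ffun I -> bool} -> U) (u : U) :
  measurable [set y | g [ffun i => P i y] = u].
Proof.
rewrite (_ : [set _ | _] = \bigcup_(b in [set b | g b = u])
   \bigcap_(i in [set: I]) [set y | P i y = b i]); last first.
  apply/seteqP; split => y /=.
    by move=> gu; exists [ffun i => P i y] => // i _ /=; rewrite ffunE.
  move=> [b /= gb yb]; rewrite (_ : [ffun i => _] = b)//.
  by apply/ffunP => i; rewrite ffunE; exact: yb.
apply: fin_bigcup_measurable; first exact: finite_finset.
move=> b _; apply: fin_bigcap_measurable; first exact: finite_finset.
move=> i _; case: (b i); first exact: mP.
rewrite (_ : [set _ | _] = ~` [set y | P i y]); first exact: measurableC.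
by apply/seteqP; split => y /=; [move=> ->|move/negP/negbTE].
Qed.

End FiniteMeasurability.

(** * Linear algebra of the feedback loop *)

Section FeedbackMatrices.
Variables (R : realType) (N s1 s2 rho : R) (eta : nat).
Variables (a1 a2 : 'cV[R]_eta) (B1 B2 : 'M[R]_eta).

(** The matrix is not triangular, but adding the second block row to the first passes to the
    coordinate X1 + X2, whose recursion has the strictly lower matrix [B1 + B2]. The conjugated
    matrix is block triangular with unit determinant. *)
Lemma unit_feedback : strictly_lower B1 -> strictly_lower B2 ->
  (1%:M - block_mx B1 B1 B2 B2) \in unitmx.
Proof.
move=> sl1 sl2; rewrite unitmxE.
pose U c : 'M[R]_(eta + eta) := block_mx 1%:M c%:M 0 1%:M.
have detU c : \det (U c) = 1 by rewrite det_ublock !det1 mulr1.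
have /(congr1 determinant) :
    U 1 *m (1%:M - block_mx B1 B1 B2 B2) *m U (-1) =
    block_mx (1%:M - (B1 + B2)) 0 (- B2) 1%:M.
  rewrite /U scalar_mx_block opp_block_mx add_block_mx !mulmx_block.
  rewrite !(mul1mx, mulmx1, mul0mx, mulmx0, add0r, addr0, sub0r, mul_mx_scalar).
  by congr block_mx; apply/matrixP => i j; rewrite !mxE; ring.
rewrite !det_mulmx !detU mul1r mulr1 => ->.
rewrite det_lblock det1 mulr1 det_trig; last first.
  apply/is_trig_mxP => i j ij; rewrite !mxE sl1 ?sl2 ?(ltnW ij)// addr0 subr0.
  by rewrite -val_eqE /= (ltn_eqF ij).
by rewrite big1 ?unitr1// => i _; rewrite !mxE sl1 ?sl2// eqxx addr0 subr0.
Qed.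

Let Inv := invmx (1%:M - block_mx B1 B1 B2 B2).
Let MA : 'M[R]_(eta + eta, 1 + 1) := Inv *m block_mx a1 0 0 a2.
Let MZ : 'M[R]_(eta + eta, eta) := Inv *m col_mx B1 B2.
Let MW : 'M[R]_(eta + eta, eta + eta) := Inv *m block_mx B1 0 0 B2.

(** [MA], [MZ], [MW] are the coefficients of the stacked inputs on the symbols, on Z and on (W1,
    W2), as [feedback_solution] shows; Sigma is the resulting covariance for uncorrelated symbols of
    unit variance. *)
Lemma SigmaSI_diag (k : 'I_(eta + eta)) :
  SigmaSI N s1 s2 rho a1 a2 B1 B2 k k =
  MA k (lshift 1 0) ^+ 2 + MA k (rshift 1 0) ^+ 2 +
  \sum_(l < eta) noise_var N s1 s2 rho
    (MZ k l, (MW k (lshift eta l), MW k (rshift eta l))).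
Proof.
rewrite /SigmaSI -/Inv !mulmxDr !mulmxDl.
rewrite (_ : Inv *m (block_mx a1 0 0 a2 *m (block_mx a1 0 0 a2)^T) *m Inv^T = MA *m MA^T);
  last by rewrite /MA trmx_mul !mulmxA.
rewrite (_ : Inv *m (N *: (col_mx B1 B2 *m (col_mx B1 B2)^T)) *m Inv^T = N *: (MZ *m MZ^T));
  last by rewrite /MZ trmx_mul -scalemxAr -scalemxAl !mulmxA.
set KW := block_mx (s1 ^+ 2)%:M _ _ _.
rewrite (_ : Inv *m (block_mx B1 0 0 B2 *m KW *m (block_mx B1 0 0 B2)^T) *m Inv^T
  = MW *m KW *m MW^T); last by rewrite /MW trmx_mul !mulmxA.
rewrite -[X in X *m KW *m X^T](hsubmxK MW) /KW mul_row_block tr_row_mx mul_row_col.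
rewrite !mul_mx_scalar !mxE big_split_ord /= !big_ord1 !mxE -!expr2 -!addrA.
congr (_ + (_ + _)); rewrite mulr_sumr -!big_split /=; apply: eq_bigr => l _.
by rewrite !mxE /noise_var /=; ring.
Qed.

Lemma feedback_solution (x1 x2 z w1 w2 : 'I_eta -> R) (xi1 xi2 : R) :
  strictly_lower B1 -> strictly_lower B2 ->
  (forall i, x1 i = a1 i 0 * xi1 +
     \sum_(l < eta) B1 i l * (x1 l + x2 l + z l + w1 l)) ->
  (forall i, x2 i = a2 i 0 * xi2 +
     \sum_(l < eta) B2 i l * (x1 l + x2 l + z l + w2 l)) ->
  forall k, col_mx (\col_i x1 i) (\col_i x2 i) k 0 =
  MA k (lshift 1 0) * xi1 + MA k (rshift 1 0) * xi2 +
  \sum_(l < eta) (MZ k l * z l + MW k (lshift eta l) * w1 l + MW k (rshift eta l) * w2 l).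
Proof.
move=> sl1 sl2 E1 E2 k.
set X := col_mx _ _.
pose Z := \col_i z i; pose W := col_mx (\col_i w1 i) (\col_i w2 i).
pose Xi : 'cV[R]_(1 + 1) := col_mx (const_mx xi1) (const_mx xi2).
have XE : (1%:M - block_mx B1 B1 B2 B2) *m X =
    block_mx a1 0 0 a2 *m Xi + col_mx B1 B2 *m Z + block_mx B1 0 0 B2 *m W.
  rewrite mulmxBl mul1mx; apply/eqP; rewrite subr_eq; apply/eqP.
  rewrite /X /Xi /W !mul_block_col mul_col_mx !mul0mx !add0r !addr0 !add_col_mx.
  congr col_mx; apply/colP => i; rewrite !mxE ?E1 ?E2 big_ord1 !mxE -!addrA;
    congr (_ + _); rewrite -!big_split /=; apply: eq_bigr => l _; rewrite !mxE; ring.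
have -> : X = MA *m Xi + MZ *m Z + MW *m W.
  by rewrite /MA /MZ /MW -!mulmxA -!mulmxDr -XE mulKmx// unit_feedback.
rewrite !mxE big_split_ord /= !big_ord1 col_mxEu col_mxEd !mxE -!addrA.
congr (_ + (_ + _)); rewrite big_split_ord /= -!big_split /=.
by apply: eq_bigr => l _; rewrite col_mxEu col_mxEd !mxE addrA.
Qed.

End FeedbackMatrices.

(** * The layered code and its error for a fixed codebook *)

Section LayeredCode.
Variables (R : realType) (eta : nat) (eta_gt0 : (0 < eta)%N).
Variables (a1 a2 : 'cV[R]_eta) (B1 B2 : 'M[R]_eta).
Variables (J1 J2 : finType) (rk : J1 + J2 -> nat) (amp : J1 + J2 -> R).
Variables (h : J1 + J2 -> 'cV[R]_eta) (theta : R).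
Variables (n K : nat) (K_gt0 : (0 < K)%N).

Notation J := (J1 + J2)%type.
Notation T := ('I_K * bool)%type.
Notation kb := (n %/ eta)%N.

Section FixedCodebook.
Variable cb : {ffun (J * 'I_K) * 'I_kb -> bool}.

Definition posn (t : nat) : 'I_eta := Ordinal (ltn_pmod t eta_gt0).

(* The boolean in [x] closes the codebook under negation; codewords are [0]
   beyond the [kb] blocks. *)
Definition cword (j : J) (x : T) (b : nat) : R :=
  if insub b is Some b' then sgb R x.2 * sgb R (cb ((j, x.1), b')) else 0.

Definition layer_msg (m1 : {ffun J1 -> T}) (m2 : {ffun J2 -> T}) (j : J) : T :=
  match j with inl i => m1 i | inr i => m2 i end.

Definition dir (j : J) : 'cV[R]_eta :=
  amp j *: (match j with inl _ => a1 | inr _ => a2 end).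

Definition xi1 (m1 : {ffun J1 -> T}) (b : nat) : R :=
  \sum_(j : J1) amp (inl j) * cword (inl j) (m1 j) b.
Definition xi2 (m2 : {ffun J2 -> T}) (b : nat) : R :=
  \sum_(j : J2) amp (inr j) * cword (inr j) (m2 j) b.

(** The sum runs over the whole block: entries not yet received default to 0, and for them the
    strictly lower [B] has zero coefficients. Times beyond the last full block are silent. *)
Definition encode (a : 'cV[R]_eta) (B : 'M[R]_eta) (xi : nat -> R) (t : nat)
    (v : seq R) : R :=
  if (t %/ eta < kb)%N then
    a (posn t) 0 * xi (t %/ eta)%N +
    \sum_(l < eta) B (posn t) l * nth 0 v (t %/ eta * eta + l)
  else 0.

Lemma measurable_nth (t k : nat) :
  measurable_fun [set: t.-tuple R] (fun v : t.-tuple R => nth 0 (tval v) k).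
Proof.
have [kt|tk] := ltnP k t.
  rewrite (_ : (fun _ => _) = (fun v : t.-tuple R => tnth v (Ordinal kt))).
    exact: measurable_tnth.
  by apply/funext => v; rewrite (tnth_nth 0).
rewrite (_ : (fun _ => _) = cst 0); first exact: measurable_cst.
by apply/funext => v; rewrite nth_default// size_tuple.
Qed.

Lemma measurable_encode a B xi (t : nat) :
  measurable_fun [set: t.-tuple R] (fun v : t.-tuple R => encode a B xi t (tval v)).
Proof.
rewrite /encode; case: (t %/ eta < kb)%N; last exact: measurable_cst.
apply: measurable_funD; first exact: measurable_cst.
apply: measurable_sum => l; apply: measurable_funM; first exact: measurable_cst.
exact: measurable_nth.
Qed.

(* [Y - B1 V1 - B2 V2] on block [b], which equals [a1 xi1 + a2 xi2 + Z]. *)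
Definition reduced (y w1 w2 : seq R) (b : nat) (i : 'I_eta) : R :=
  nth 0 y (b * eta + i)
  - \sum_(l < eta) B1 i l * (nth 0 y (b * eta + l) + nth 0 w1 (b * eta + l))
  - \sum_(l < eta) B2 i l * (nth 0 y (b * eta + l) + nth 0 w2 (b * eta + l)).

Definition score (r : nat -> 'I_eta -> R) (mm : J -> T) (j : J) (x : T) : R :=
  \sum_(b < kb) cword j x b * \sum_(i < eta) h j i 0 *
    (r b i - \sum_(j' | (rk j' < rk j)%N) dir j' i 0 * cword j' (mm j') b).

(** Successive decoding stated as a test of a complete candidate, whose own earlier entries form the
    residuals. On the true message these are the genuine residuals, so error propagation never has
    to be analysed. *)
Definition accepts r (mm : J -> T) : bool :=
  [forall j, (theta * kb%:R <= score r mm j (mm j)) &&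
             [forall x, (x != mm j) ==> (score r mm j x < theta * kb%:R)]].

Definition msg_default1 : {ffun J1 -> T} := [ffun=> (Ordinal K_gt0, false)].
Definition msg_default2 : {ffun J2 -> T} := [ffun=> (Ordinal K_gt0, false)].

Notation MM := ({ffun J1 -> T} * {ffun J2 -> T})%type.

(** Factored through the finite table of acceptance bits, the form required by
    [measurable_boolfun]. *)
Definition decode_pick (acc : {ffun MM -> bool}) : 'I_#|{ffun J1 -> T}| * 'I_#|{ffun J2 -> T}| :=
  let mm := odflt (msg_default1, msg_default2) [pick mm | acc mm] in
  (enum_rank mm.1, enum_rank mm.2).

Definition decode (y w1 w2 : n.-tuple R) :=
  decode_pick [ffun mm : MM => accepts (reduced y w1 w2) (layer_msg mm.1 mm.2)].

Lemma measurable_accepts (mm : MM) :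
  measurable [set y : n.-tuple R * (n.-tuple R * n.-tuple R) |
    accepts (reduced y.1 y.2.1 y.2.2) (layer_msg mm.1 mm.2)].
Proof.
pose TT : Type := (n.-tuple R * (n.-tuple R * n.-tuple R))%type.
have my k : measurable_fun setT (fun y : TT => nth 0 (tval y.1) k).
  exact: (measurableT_comp (measurable_nth k) measurable_fst).
have mw1 k : measurable_fun setT (fun y : TT => nth 0 (tval y.2.1) k).
  apply: (measurableT_comp (measurable_nth k)).
  exact: (measurableT_comp measurable_fst measurable_snd).
have mw2 k : measurable_fun setT (fun y : TT => nth 0 (tval y.2.2) k).
  apply: (measurableT_comp (measurable_nth k)).
  exact: (measurableT_comp measurable_snd measurable_snd).
have ms j x : measurable_fun setT (fun y : TT =>
    score (reduced y.1 y.2.1 y.2.2) (layer_msg mm.1 mm.2) j x).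
  apply: measurable_sum => b; apply: measurable_funM; first exact: measurable_cst.
  apply: measurable_sum => i; apply: measurable_funM; first exact: measurable_cst.
  apply: measurable_funB; last exact: measurable_cst.
  apply: measurable_funB; first apply: measurable_funB; first exact: my.
    apply: measurable_sum => l; apply: measurable_funM; first exact: measurable_cst.
    exact: measurable_funD.
  apply: measurable_sum => l; apply: measurable_funM; first exact: measurable_cst.
  exact: measurable_funD.
rewrite (_ : [set _ | _] = \bigcap_(j in [set: J]) \bigcap_(x in [set: T])
  [set y : TT | if x == layer_msg mm.1 mm.2 j
    then theta * kb%:R <= score (reduced y.1 y.2.1 y.2.2) (layer_msg mm.1 mm.2) j x
    else score (reduced y.1 y.2.1 y.2.2) (layer_msg mm.1 mm.2) j x < theta * kb%:R]); last first.
  apply/seteqP; split => y /=.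
    move=> /forallP acc j _ x _ /=; have /andP[A /forallP C] := acc j.
    by case: eqVneq => [->//|xn]; have := C x; rewrite xn.
  move=> acc; apply/forallP => j; apply/andP; split.
    by have := acc j I (layer_msg mm.1 mm.2 j) I; rewrite /= eqxx.
  by apply/forallP => x; apply/implyP => xn; have := acc j I x I; rewrite /= (negbTE xn).
apply: fin_bigcap_measurable; first exact: finite_finset.
move=> j _; apply: fin_bigcap_measurable; first exact: finite_finset.
move=> x _; case: (x == layer_msg mm.1 mm.2 j).
  have := ms j x measurableT `[theta * kb%:R, +oo[%classic (measurable_itv _).
  rewrite setTI; congr (measurable _); apply/seteqP; split => y /=; rewrite in_itv/= andbT//.
have := ms j x measurableT `]-oo, theta * kb%:R[%classic (measurable_itv _).
rewrite setTI; congr (measurable _); apply/seteqP; split => y /=; rewrite in_itv/=//.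
Qed.

Lemma measurable_decode (mm : 'I_#|{ffun J1 -> T}| * 'I_#|{ffun J2 -> T}|) :
  measurable [set y : n.-tuple R * (n.-tuple R * n.-tuple R) |
    decode y.1 y.2.1 y.2.2 = mm].
Proof. exact: (measurable_boolfun measurable_accepts). Qed.

Lemma card_msg_gt0 (I : finType) : (0 < #|{ffun I -> T}|)%N.
Proof. by apply/card_gt0P; exists [ffun=> (Ordinal K_gt0, false)]. Qed.

Definition layered_code : code R n :=
  @Code R n #|{ffun J1 -> T}| #|{ffun J2 -> T}| (card_msg_gt0 J1) (card_msg_gt0 J2)
    (fun m => encode a1 B1 (xi1 (enum_val m)))
    (fun m => encode a2 B2 (xi2 (enum_val m)))
    decode
    (fun m => measurable_encode a1 B1 (xi1 (enum_val m)))
    (fun m => measurable_encode a2 B2 (xi2 (enum_val m)))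
    measurable_decode.

(* A layer is decoded from the residual left by the earlier ones, so two
   accepted message vectors agree by induction on the rank. *)
Lemma accepts_inj r (mm mm' : J -> T) :
  accepts r mm -> accepts r mm' -> mm =1 mm'.
Proof.
move=> /forallP A /forallP A' j.
have [m] := ubnP (rk j); elim: m j => // m IH j; rewrite ltnS => jm.
have sE x : score r mm j x = score r mm' j x.
  apply: eq_bigr => b _; congr (_ * _); apply: eq_bigr => i _; congr (_ * (_ - _)).
  by apply: eq_bigr => j' j'j; rewrite IH// (leq_trans j'j jm).
apply/eqP/negPn/negP => ne.
have /andP[/le_lt_trans H _] := A j; have /andP[_ /forallP/(_ (mm j))] := A' j.
by rewrite ne /= -sE => /H; rewrite ltxx.
Qed.

Lemma decode_pickE (acc : {ffun MM -> bool}) (mm : MM) :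
  acc mm -> (forall mm', acc mm' -> mm' = mm) ->
  decode_pick acc = (enum_rank mm.1, enum_rank mm.2).
Proof.
rewrite /decode_pick; case: pickP => [mm' A' _ /(_ _ A') ->//|/(_ mm)].
by move=> -> .
Qed.

Lemma block_lt b (i : 'I_eta) : (b < kb)%N -> (b * eta + i < n)%N.
Proof.
move=> bk; apply: (@leq_trans (kb * eta)%N); last exact: leq_trunc_div.
apply: (@leq_trans (b.+1 * eta)%N); last by rewrite leq_mul2r bk orbT.
by rewrite mulSn addnC ltn_add2r.
Qed.

Lemma block_div b (i : 'I_eta) : ((b * eta + i) %/ eta = b)%N.
Proof. by rewrite divnMDl// divn_small// addn0. Qed.

Lemma block_posn b (i : 'I_eta) : posn (b * eta + i) = i.
Proof. by apply/val_inj; rewrite /= modnMDl modn_small. Qed.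

Lemma big_nat_blocks (F : nat -> R) k : \sum_(0 <= t < k * eta) F t =
  \sum_(b < k) \sum_(i < eta) F (b * eta + i)%N.
Proof.
elim: k => [|k IH]; first by rewrite big_ord0 big_geq.
rewrite big_ord_recr /= mulSn addnC.
rewrite (big_cat_nat (leq0n _) (leq_addr eta (k * eta)%N)) /= IH.
congr (_ + _); rewrite -{1}[(k * eta)%N]add0n big_addn addKn big_mkord.
by apply: eq_bigr => i _; rewrite addnC.
Qed.

Lemma block_sum (F : nat -> R) : (forall t, (kb <= t %/ eta)%N -> F t = 0) ->
  \sum_(t < n) F t = \sum_(b < kb) \sum_(i < eta) F (b * eta + i)%N.
Proof.
move=> F0; have le := leq_trunc_div n eta.
rewrite -(big_mkord xpredT F) (big_cat_nat (leq0n _) le) /= big_nat_blocks.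
rewrite (_ : \sum_(kb * eta <= t < n) F t = 0) ?addr0//.
rewrite big_nat_cond big1// => t /andP[/andP[kt _] _].
by rewrite F0// leq_divRL.
Qed.

Lemma encode_block a B xi b (i : 'I_eta) (V : nat -> R) :
  strictly_lower B -> (b < kb)%N ->
  encode a B xi (b * eta + i) (mkseq V (b * eta + i)) =
  a i 0 * xi b + \sum_(l < eta) B i l * V (b * eta + l)%N.
Proof.
move=> sl bk; rewrite /encode block_div bk block_posn; congr (_ + _).
apply: eq_bigr => l _; have [li|il] := ltnP l i; last by rewrite sl// !mul0r.
by rewrite nth_mkseq// ltn_add2l.
Qed.

Lemma cword_sqr j x b : (b < kb)%N -> cword j x b * cword j x b = 1.
Proof.
move=> bk; rewrite /cword insubT /=.
by rewrite mulrACA !sgb_sqr mulr1.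
Qed.

Lemma cword_neg j x b : cword j (x.1, ~~ x.2) b = - cword j x b.
Proof.
rewrite /cword; case: insub => [b'|] /=; last by rewrite oppr0.
by rewrite /sgb signrN mulNr.
Qed.

Lemma cword_out j x b : (kb <= b)%N -> cword j x b = 0.
Proof. by move=> bk; rewrite /cword insubF// ltnNge bk. Qed.

Section Run.
Hypotheses (slB1 : strictly_lower B1) (slB2 : strictly_lower B2).
Variables (m1 : 'I_#|{ffun J1 -> T}|) (m2 : 'I_#|{ffun J2 -> T}|).
Variable e : nat -> R * (R * R).
Let x1 := enum_val m1.
Let x2 := enum_val m2.
Let mm := layer_msg x1 x2.
Let Y := @Yat R n layered_code m1 m2 e.

Lemma X1_block b (i : 'I_eta) : (b < kb)%N ->
  @X1 R n layered_code m1 m2 e (b * eta + i) =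
  a1 i 0 * xi1 x1 b +
  \sum_(l < eta) B1 i l * (Y (b * eta + l) + (e (b * eta + l)%N).2.1).
Proof.
move=> bk; have [-> _] := @X_rec R n layered_code m1 m2 e _ (block_lt i bk).
exact: encode_block.
Qed.

Lemma X2_block b (i : 'I_eta) : (b < kb)%N ->
  @X2 R n layered_code m1 m2 e (b * eta + i) =
  a2 i 0 * xi2 x2 b +
  \sum_(l < eta) B2 i l * (Y (b * eta + l) + (e (b * eta + l)%N).2.2).
Proof.
move=> bk; have [_ ->] := @X_rec R n layered_code m1 m2 e _ (block_lt i bk).
exact: encode_block.
Qed.

Let red := reduced (@Yseq R n layered_code m1 m2 e) (W1seq n e) (W2seq n e).

Lemma reduced_run b (i : 'I_eta) : (b < kb)%N ->
  red b i = \sum_j dir j i 0 * cword j (mm j) b + (e (b * eta + i)%N).1.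
Proof.
move=> bk.
have yE (l : 'I_eta) : nth 0 (@Yseq R n layered_code m1 m2 e) (b * eta + l) = Y (b * eta + l).
  by have := tnth_nth 0 (@Yseq R n layered_code m1 m2 e) (Ordinal (block_lt l bk)); rewrite tnth_Yseq.
have w1E (l : 'I_eta) : nth 0 (W1seq n e) (b * eta + l) = (e (b * eta + l)%N).2.1.
  by have := tnth_nth 0 (W1seq n e) (Ordinal (block_lt l bk)); rewrite tnth_mktuple.
have w2E (l : 'I_eta) : nth 0 (W2seq n e) (b * eta + l) = (e (b * eta + l)%N).2.2.
  by have := tnth_nth 0 (W2seq n e) (Ordinal (block_lt l bk)); rewrite tnth_mktuple.
rewrite /red /reduced yE.
under eq_bigr do rewrite yE w1E.
under [X in _ - _ - X]eq_bigr do rewrite yE w2E.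
rewrite {1}/Y /Yat X1_block// X2_block// -/Y.
have E1 : \sum_j dir (inl j) i 0 * cword (inl j) (mm (inl j)) b = a1 i 0 * xi1 x1 b.
  by rewrite /xi1 mulr_sumr; apply: eq_bigr => j _; rewrite /dir mxE /mm /=; ring.
have E2 : \sum_j dir (inr j) i 0 * cword (inr j) (mm (inr j)) b = a2 i 0 * xi2 x2 b.
  by rewrite /xi2 mulr_sumr; apply: eq_bigr => j _; rewrite /dir mxE /mm /=; ring.
by rewrite big_sumType /= E1 E2; ring.
Qed.

Definition gain j j' : R := \sum_(i < eta) h j i 0 * dir j' i 0.

Definition signal (j : J) (x : T) : R := \sum_(b < kb) cword j x b *
  \sum_(j' | (rk j <= rk j')%N) gain j j' * cword j' (mm j') b.

(** The true earlier layers cancel, and those of rank at least [rk j] remain. Layer [j] itself is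
    among them: it is the useful signal when [x] is true, and interference when [x] is false. *)
Lemma score_run j x : score red mm j x = signal j x +
  \sum_(t < n) cword j x (t %/ eta) * h j (posn t) 0 * (e t).1.
Proof.
rewrite (block_sum (F := fun t => cword j x (t %/ eta) * h j (posn t) 0 * (e t).1)); last first.
  by move=> t kt; rewrite cword_out// !mul0r.
rewrite /score /signal -big_split/=; apply: eq_bigr => b _.
under [X in _ = _ + X]eq_bigr do rewrite block_div block_posn -mulrA.
rewrite -mulr_sumr -mulrDr; congr (_ * _).
under eq_bigr => i _.
  rewrite reduced_run// (bigID (fun j' => (rk j' < rk j)%N)) /=.
  rewrite -[X in _ * (X - _)]addrA [X in _ * X]addrC addKr mulrDr.
  over.
rewrite big_split/=; congr (_ + _).
under eq_bigr do rewrite mulr_sumr.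
rewrite exchange_big/=; apply: eq_big => [j'|j' _]; first by rewrite -leqNgt.
by rewrite /gain mulr_suml; apply: eq_bigr => i _; rewrite mulrA.
Qed.

(** Chernoff majorants of two bad events: a true codeword scoring below the threshold (tilt [- l1])
    and a false one reaching it (tilt [l2]). *)
Definition err_term (l1 l2 : R) (s : J -> T -> R) (jx : J * T) : R :=
  if (jx.2.1 == (mm jx.1).1) && (jx.2 != mm jx.1) then 0 else
    expR ((if jx.2 == mm jx.1 then - l1 else l2) * (s jx.1 jx.2 - theta * kb%:R)).

(* The antipodal codeword needs no union-bound term: its score is the opposite
   of the true one. *)
Lemma decoding_error_le (l1 l2 : R) : 0 <= l1 -> 0 <= l2 -> 0 < theta -> (0 < kb)%N ->
  (@decoding_error R n layered_code m1 m2 e)%:R <=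
  \sum_(jx : J * T) err_term l1 l2 (score red mm) jx.
Proof.
move=> l1_ge0 l2_ge0 th0 k0.
pose F := err_term l1 l2 (score red mm).
have expge (y : R) : 0 <= y -> 1 <= expR y by rewrite -[1]expR0 ler_expR.
have F0 jx : 0 <= F jx by rewrite /F /err_term; case: ifP => // _; exact: expR_ge0.
have F1 jx : 1 <= F jx -> 1 <= \sum_i F i.
  move=> H; rewrite (bigD1 jx)//= (le_trans H)// lerDl.
  by apply: sumr_ge0 => i _; exact: F0.
have kth : 0 < theta * kb%:R by rewrite mulr_gt0 ?ltr0n.
case E : (decoding_error _ _ _); last by apply: sumr_ge0 => i _; exact: F0.
have : ~~ accepts red mm.
  apply/negP => acc; move: E; rewrite /decoding_error /= /decode.
  rewrite (@decode_pickE _ (x1, x2)) ?enum_valK ?eqxx// ?ffunE//.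
  move=> [y1 y2]; rewrite ffunE /= => acc'.
  have H := accepts_inj acc' acc.
  congr pair; apply/ffunP => i; [exact: (H (inl i))|exact: (H (inr i))].
rewrite negb_forall => /existsP[j]; rewrite negb_and -ltNge => /orP[bad|].
  apply: (F1 (j, mm j)); rewrite /F /err_term /= !eqxx /=.
  by apply: expge; rewrite mulNr oppr_ge0 mulr_ge0_le0// subr_le0; exact: ltW.
rewrite negb_forall => /existsP[x]; rewrite negb_imply -leNgt => /andP[xn bad].
have [xm|xm] := eqVneq x.1 (mm j).1.
  have xE : x = ((mm j).1, ~~ (mm j).2).
    move: xn xm; case: x {bad} => [y s]; case: (mm j) => [y' s'] /= + E'.
    by rewrite E' xpair_eqE eqxx /=; case: s; case: s'.
  have sN : score red mm j x = - score red mm j (mm j).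
    rewrite xE /score -sumrN; apply: eq_bigr => b _.
    by rewrite cword_neg mulNr.
  apply: (F1 (j, mm j)); rewrite /F /err_term /= !eqxx /=.
  apply: expge; rewrite mulNr oppr_ge0 mulr_ge0_le0//.
  by move: bad; rewrite sN; lra.
apply: (F1 (j, x)); rewrite /F /err_term /= (negbTE xm) (negbTE xn) /=.
by apply: expge; rewrite mulr_ge0// subr_ge0.
Qed.

End Run.

Definition hnorm (j : J) : R := \sum_(i < eta) h j i 0 ^+ 2.

Variables (N s1 s2 rho : R).
Hypotheses (N_gt0 : 0 < N) (rho1 : -1 <= rho <= 1).

Definition tilt (mm : J -> T) (l1 l2 : R) (jx : J * T) : R :=
  if jx.2 == mm jx.1 then - l1 else l2.

Definition err_mean (m1 : 'I_#|{ffun J1 -> T}|) (m2 : 'I_#|{ffun J2 -> T}|)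
    (l1 l2 : R) (jx : J * T) : R :=
  let mm := layer_msg (enum_val m1) (enum_val m2) in
  let k := tilt mm l1 l2 jx in
  if (jx.2.1 == (mm jx.1).1) && (jx.2 != mm jx.1) then 0 else
  expR (k * (signal m1 m2 jx.1 jx.2 - theta * kb%:R)
        + k ^+ 2 * (N * hnorm jx.1) * kb%:R / 2).

Lemma noise_error_le (l1 l2 : R) m1 m2 : strictly_lower B1 -> strictly_lower B2 ->
  0 <= l1 -> 0 <= l2 -> 0 < theta -> (0 < kb)%N ->
  (noise_expect N s1 s2 rho (fun s : n.-tuple (R * (R * R)) =>
     (@decoding_error R n layered_code m1 m2 (noise_fun s))%:R%:E) <=
  (\sum_(jx : J * T) err_mean m1 m2 l1 l2 jx)%:E)%E.
Proof.
move=> sl1 sl2 l10 l20 th0 k0.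
set mm := layer_msg (enum_val m1) (enum_val m2).
pose bad (jx : J * T) := (jx.2.1 == (mm jx.1).1) && (jx.2 != mm jx.1).
pose k := tilt mm l1 l2.
pose c (jx : J * T) := if bad jx then 0 else
  expR (k jx * (signal m1 m2 jx.1 jx.2 - theta * kb%:R)).
(* Only Z survives in the score. As codewords are signs, its variance proxy depends on the filter
   and not on the codebook. *)
pose p (jx : J * T) (t : nat) : R * (R * R) :=
  (k jx * (cword jx.1 jx.2 (t %/ eta) * h jx.1 (posn t) 0), (0, 0)).
have pV jx : \sum_(t < n) noise_var N s1 s2 rho (p jx t) =
    k jx ^+ 2 * (N * hnorm jx.1) * kb%:R.
  rewrite (block_sum (F := fun t => noise_var N s1 s2 rho (p jx t))); last first.
    by move=> t kt; rewrite /p cword_out// mul0r mulr0 /noise_var /=; ring.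
  rewrite -[kb%:R]mulr1 -[in RHS](card_ord kb) mulr_natl -sumr_const mulr_sumr.
  apply: eq_bigr => b _; rewrite mulr1 /hnorm !mulr_sumr; apply: eq_bigr => i _.
  rewrite /noise_var /p /= block_div block_posn.
  have := @cword_sqr jx.1 jx.2 b (ltn_ord b); set w := cword _ _ _ => w2.
  rewrite (_ : _ + _ = N * (k jx ^+ 2 * (w * w) * h jx.1 i 0 ^+ 2)); last by ring.
  by rewrite w2; ring.
apply: (@le_trans _ _ (noise_expect N s1 s2 rho (fun s : n.-tuple (R * (R * R)) =>
    (\sum_(jx <- index_enum ((J * T)%type)) c jx *
       expR (\sum_(t < n) noise_form (p jx t) (noise_fun s t)))%:E))).
  apply: le_noise_expect => s; first by rewrite lee_fin ler0n.
  rewrite lee_fin.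
  apply: le_trans (@decoding_error_le m1 m2 (noise_fun s) l1 l2 l10 l20 th0 k0) _.
  apply: ler_sum => jx _; rewrite /err_term /c /bad; case: ifP => _; first by rewrite mul0r.
  rewrite score_run// -expRD ler_expR -/mm -/(k jx) -/(tilt mm l1 l2 jx) -/k.
  rewrite [leLHS](_ : _ = k jx * (signal m1 m2 jx.1 jx.2 - theta * kb%:R) + k jx *
    \sum_(t < n) cword jx.1 jx.2 (t %/ eta) * h jx.1 (posn t) 0 * (noise_fun s t).1); last by ring.
  rewrite lerD2l mulr_sumr; apply: ler_sum => t _.
  by rewrite /noise_form /p /= mulrA !mul0r !addr0.
rewrite noise_expect_exp// lee_fin; apply: ler_sum => jx _.
rewrite /c /err_mean -/mm -/(bad jx); case: ifP => _; first by rewrite mul0r.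
by rewrite -expRD ler_expR pV.
Qed.

End FixedCodebook.

(** Used to write interference as a linear form in all codebook rows, supported on the rows that the
    messages select. *)
Lemma sum_graph (f : J -> 'I_K) (P : pred J) (F : J -> R) :
  \sum_(q : J * 'I_K) (if (q.2 == f q.1) && P q.1 then F q.1 else 0) =
  \sum_(j | P j) F j.
Proof.
rewrite -(pair_bigA _ (fun j y => if (y == f j) && P j then F j else 0)) /=.
rewrite [RHS]big_mkcond; apply: eq_bigr => j _.
rewrite (bigD1 (f j))//= eqxx big1 ?addr0// => y /negbTE -> //.
Qed.

Lemma cwordE (cb : {ffun (J * 'I_K) * 'I_kb -> bool}) j x (b : 'I_kb) :
  cword cb j x b = sgb R x.2 * sgb R (cb ((j, x.1), b)).
Proof. by rewrite /cword valK. Qed.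

(** * Average of the error bound over codebooks *)

Section CodebookAverage.
Variables (N vs : R).
Hypotheses (N_gt0 : 0 < N) (rk_inj : injective rk).
Hypothesis gain_self : forall j, gain j j = vs.
Hypothesis gain_later : forall j,
  N * hnorm j + \sum_(j' | (rk j < rk j')%N) gain j j' ^+ 2 <= vs.
Variables (m1 : 'I_#|{ffun J1 -> T}|) (m2 : 'I_#|{ffun J2 -> T}|).
Let mm := layer_msg (enum_val m1) (enum_val m2).
Let CB := {ffun (J * 'I_K) * 'I_kb -> bool}.

Lemma later_eq j j' : (rk j <= rk j')%N && (j' != j) = (rk j < rk j')%N.
Proof.
rewrite ltn_neqAle andbC; congr (_ && _).
by rewrite (inj_eq rk_inj) eq_sym.
Qed.

(** The condition on [P] says that the row of [x] is not one of the interfering rows; this is the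
    vanishing weight that [sum_correlation_le] asks for. *)
Lemma sum_cross_le j (x : T) (P : pred J) (k : R) :
  ((mm j).1 == x.1) && P j = false ->
  \sum_(cb : CB) expR (k * \sum_(b < kb) cword cb j x b *
      \sum_(j' | P j') gain j j' * cword cb j' (mm j') b) <=
  #|CB|%:R * expR (kb%:R * (k ^+ 2 * \sum_(j' | P j') gain j j' ^+ 2) / 2).
Proof.
move=> Pj.
pose w (q : J * 'I_K) := if (q.2 == (mm q.1).1) && P q.1 then
  k * sgb R x.2 * sgb R (mm q.1).2 * gain j q.1 else 0.
have wp : w (j, x.1) = 0 by rewrite /w /= eq_sym Pj.
have := @sum_correlation_le R _ kb (j, x.1) w wp.
rewrite (_ : \sum_q w q ^+ 2 = k ^+ 2 * \sum_(j' | P j') gain j j' ^+ 2); last first.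
  rewrite mulr_sumr -(sum_graph (fun j => (mm j).1)); apply: eq_bigr => q _.
  rewrite /w; case: ifP => _; last by rewrite expr0n.
  by rewrite !exprMn !sqrr_sign !mulr1.
apply: le_trans; apply: ler_sum => cb _; rewrite ler_expR mulr_sumr.
apply: ler_sum => b _.
rewrite cwordE (_ : \sum_q _ = k * sgb R x.2 *
   \sum_(j' | P j') gain j j' * cword cb j' (mm j') b).
  by rewrite le_eqVlt; apply/orP; left; apply/eqP; ring.
rewrite mulr_sumr -(sum_graph (fun j => (mm j).1)); apply: eq_bigr => q _.
rewrite /w; case: ifP => [/andP[/eqP qE _]|_]; last by rewrite mul0r.
by rewrite cwordE -qE -surjective_pairing; ring.
Qed.

(** Filters are scaled so that the gain is [vs] and noise plus later layers have variance proxy at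
    most [vs]. For a false codeword the true layer adds the square of its gain, whence
    [vs ^+ 2 + vs]. *)
Lemma sum_err_mean_le (l1 l2 : R) jx : \sum_(cb : CB) err_mean cb N m1 m2 l1 l2 jx <=
  #|CB|%:R *
  ((if jx.2 == mm jx.1 then
     expR (kb%:R * (- l1 * (vs - theta) + l1 ^+ 2 * vs / 2)) else 0) +
   expR (kb%:R * (- l2 * theta + l2 ^+ 2 * (vs ^+ 2 + vs) / 2))).
Proof.
case: jx => j x /=.
have k0 : 0 <= kb%:R :> R by [].
rewrite /err_mean -/mm /tilt /=; have [->|xm] := eqVneq x (mm j).
  rewrite eqxx /=.
  set L2 := expR (_ * (- l2 * _ + _)).
  apply: (@le_trans _ _ (#|CB|%:R *
    expR (kb%:R * (- l1 * (vs - theta) + l1 ^+ 2 * vs / 2)))); last first.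
    by rewrite ler_wpM2l// lerDl expR_ge0.
  have P0 : ((mm j).1 == (mm j).1) && (rk j < rk j)%N = false by rewrite ltnn andbF.
  have := @sum_cross_le j (mm j) (fun j' => rk j < rk j')%N (- l1) P0.
  set S := \sum_(j' | _) gain j j' ^+ 2 => H.
  have := gain_later j; rewrite -/S => Sle.
  pose C := - l1 * (vs - theta) * kb%:R + l1 ^+ 2 * (N * hnorm j) * kb%:R / 2.
  apply: (@le_trans _ _ (expR C * (#|CB|%:R * expR (kb%:R * ((- l1) ^+ 2 * S) / 2)))).
    apply: le_trans (ler_wpM2l (expR_ge0 C) H).
    rewrite [leRHS]mulr_sumr; apply: ler_sum => cb _; rewrite -expRD ler_expR.
    rewrite (_ : signal cb m1 m2 j (mm j) = vs * kb%:R +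
      \sum_(b < kb) cword cb j (mm j) b *
       \sum_(j' | (rk j < rk j')%N) gain j j' * cword cb j' (mm j') b).
      by rewrite /C sqrrN; lra.
    have -> : vs * kb%:R = \sum_(b < kb) vs by rewrite sumr_const card_ord mulr_natr.
    rewrite -big_split/=.
    apply: eq_bigr => b _; rewrite (bigD1 j)//= gain_self mulrDr mulrCA cword_sqr// mulr1.
    by congr (_ + _ * _); apply: eq_bigl => j'; exact: later_eq.
  rewrite mulrCA ler_wpM2l// -expRD ler_expR /C sqrrN.
  suff : kb%:R * l1 ^+ 2 * (N * hnorm j + S) <= kb%:R * l1 ^+ 2 * vs by lra.
  by rewrite ler_wpM2l// mulr_ge0// sqr_ge0.
rewrite andbT add0r; case: (boolP (x.1 == (mm j).1)) => [_|xm1].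
  by rewrite big1// mulr_ge0// expR_ge0.
have P0 : ((mm j).1 == x.1) && (rk j <= rk j)%N = false by rewrite eq_sym (negbTE xm1).
have := @sum_cross_le j x (fun j' => rk j <= rk j')%N l2 P0.
set S := \sum_(j' | _) gain j j' ^+ 2 => H.
have SE : S = vs ^+ 2 + \sum_(j' | (rk j < rk j')%N) gain j j' ^+ 2.
  rewrite /S (bigD1 j)//= gain_self; congr (_ + _).
  by apply: eq_bigl => j'; exact: later_eq.
pose C := - l2 * theta * kb%:R + l2 ^+ 2 * (N * hnorm j) * kb%:R / 2.
apply: (@le_trans _ _ (expR C * (#|CB|%:R * expR (kb%:R * (l2 ^+ 2 * S) / 2)))).
  apply: le_trans (ler_wpM2l (expR_ge0 C) H).
  rewrite [leRHS]mulr_sumr; apply: ler_sum => cb _; rewrite -expRD ler_expR.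
  by rewrite /signal -/mm /C; lra.
rewrite mulrCA ler_wpM2l// -expRD ler_expR /C SE.
have := gain_later j; set Q := \sum_(j' | _) _ => Qle.
suff : kb%:R * l2 ^+ 2 * (N * hnorm j + Q) <= kb%:R * l2 ^+ 2 * vs by lra.
by rewrite ler_wpM2l// mulr_ge0// sqr_ge0.
Qed.

End CodebookAverage.

(** * Moments of the transmitted symbols *)

Section LayerMoments.
Variables (cb : {ffun (J * 'I_K) * 'I_kb -> bool}) (I : finType) (io : I -> J).
Variable b : nat.
Let xi (m : {ffun I -> T}) : R := \sum_i amp (io i) * cword cb (io i) (m i) b.

(** Flipping one sign bit of the message negates the codeword of that layer, so means and cross
    moments vanish under uniform messages, for every codebook. *)
Let flip i (m : {ffun I -> T}) : {ffun I -> T} :=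
  [ffun i' => if i' == i then ((m i).1, ~~ (m i).2) else m i'].

Let flipK i : involutive (flip i).
Proof.
move=> m; apply/ffunP => i'; rewrite !ffunE eqxx; case: eqP => [->|//].
by rewrite /= negbK -surjective_pairing.
Qed.

Let sum_flip i (F : {ffun I -> T} -> R) : (forall m, F (flip i m) = - F m) ->
  \sum_m F m = 0.
Proof.
move=> FN; have : \sum_m F m = - \sum_m F m.
  rewrite {1}(reindex_inj (inv_inj (@flipK i))) /= -sumrN.
  by apply: eq_bigr => m _.
by lra.
Qed.

Lemma sum_xi : \sum_m xi m = 0.
Proof.
rewrite exchange_big big1//= => i _; apply: (@sum_flip i) => m.
by rewrite ffunE eqxx cword_neg mulrN.
Qed.

Lemma sum_xi_sqr : (b < kb)%N ->
  \sum_m xi m ^+ 2 = #|{ffun I -> T}|%:R * \sum_i amp (io i) ^+ 2.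
Proof.
move=> bk; under eq_bigr => m _.
  rewrite expr2 mulr_suml.
  under eq_bigr => i _ do rewrite mulr_sumr.
  over.
rewrite exchange_big mulr_sumr /=; apply: eq_bigr => i _.
rewrite exchange_big (bigD1 i)//= [X in _ + X]big1 ?addr0 => [|i' ii'].
  rewrite (eq_bigr (fun=> amp (io i) ^+ 2)).
    by rewrite sumr_const mulr_natl.
  by move=> m _; rewrite mulrACA cword_sqr// mulr1 -expr2.
apply: (@sum_flip i) => m.
by rewrite !ffunE eqxx (negbTE ii') cword_neg; ring.
Qed.

End LayerMoments.

Lemma msg_avg_le (c : code R n) (F : 'I_(K1 c) -> 'I_(K2 c) -> \bar R)
    (f : 'I_(K1 c) -> 'I_(K2 c) -> R) : (forall m1 m2, F m1 m2 <= (f m1 m2)%:E)%E ->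
  (msg_avg F <= (((K1 c)%:R * (K2 c)%:R)^-1 * \sum_m1 \sum_m2 f m1 m2)%:E)%E.
Proof.
move=> Ff; rewrite /msg_avg EFinM lee_wpmul2l//.
rewrite -sumEFin; apply: lee_sum => m1 _.
by rewrite -sumEFin; apply: lee_sum => m2 _.
Qed.

Lemma sumr_card (I : finType) (x : R) : \sum_(i : I) x = #|I|%:R * x.
Proof. by rewrite sumr_const mulr_natl. Qed.

(** Independence of the two messages: the cross term is a multiple of the product of the two sums,
    one of which is 0. *)
Lemma sum_bilinear_le (I1 I2 : finType) (f : I1 -> R) (g : I2 -> R) (al be V : R) :
  (0 < #|I1|)%N -> (0 < #|I2|)%N ->
  \sum_i f i = 0 -> \sum_i f i ^+ 2 <= #|I1|%:R -> \sum_i g i ^+ 2 <= #|I2|%:R ->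
  (#|I1|%:R * #|I2|%:R)^-1 * \sum_i1 \sum_i2 ((al * f i1 + be * g i2) ^+ 2 + V) <=
  al ^+ 2 + be ^+ 2 + V.
Proof.
move=> i1 i2 f0 f2 g2.
have n1 : 0 < #|I1|%:R :> R by rewrite ltr0n.
have n2 : 0 < #|I2|%:R :> R by rewrite ltr0n.
rewrite mulrC ler_pdivrMr ?mulr_gt0//.
rewrite (_ : \sum_i1 _ = al ^+ 2 * #|I2|%:R * \sum_i f i ^+ 2
   + 2 * al * be * (\sum_i f i) * (\sum_i g i)
   + be ^+ 2 * #|I1|%:R * \sum_i g i ^+ 2 + #|I1|%:R * #|I2|%:R * V).
  rewrite f0 mulr0 mul0r addr0.
  have A2 := sqr_ge0 al; have A3 := sqr_ge0 be.
  have := ler_wpM2l (mulr_ge0 A2 (ltW n2)) f2.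
  have := ler_wpM2l (mulr_ge0 A3 (ltW n1)) g2.
  by nra.
under eq_bigr => i _.
  rewrite (eq_bigr (fun i2 => (al ^+ 2 * f i ^+ 2 + V) + (2 * al * be * f i) * g i2
     + be ^+ 2 * g i2 ^+ 2)); last by move=> i' _; ring.
  rewrite !big_split /= -!mulr_sumr !sumr_card.
  over.
rewrite !big_split /= !sumr_card -!mulr_suml -!mulr_sumr.
rewrite (_ : \sum_i f i * (#|I2|%:R * f i) = #|I2|%:R * \sum_i f i ^+ 2); first by ring.
by rewrite mulr_sumr; apply: eq_bigr => i _; rewrite mulrCA -expr2.
Qed.

(** * The power constraints *)

Section Power.
Variables (N s1 s2 rho P1 P2 : R).
Hypotheses (N_gt0 : 0 < N) (rho1 : -1 <= rho <= 1).
Hypotheses (slB1 : strictly_lower B1) (slB2 : strictly_lower B2).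
Hypothesis amp1 : \sum_j amp (inl j) ^+ 2 <= 1.
Hypothesis amp2 : \sum_j amp (inr j) ^+ 2 <= 1.
Variable cb : {ffun (J * 'I_K) * 'I_kb -> bool}.
Let c := layered_code cb.
Let S := SigmaSI N s1 s2 rho a1 a2 B1 B2.

Definition block_inputs (m1 : 'I_(K1 c)) (m2 : 'I_(K2 c)) e (b : nat) : 'cV[R]_(eta + eta) :=
  col_mx (\col_i X1 m1 m2 e (b * eta + i)) (\col_i X2 m1 m2 e (b * eta + i)).

Lemma block_power b (k : 'I_(eta + eta)) : (b < kb)%N ->
  (msg_avg (c := c) (fun m1 m2 =>
     noise_expect N s1 s2 rho (fun s : n.-tuple (R * (R * R)) =>
     ((block_inputs m1 m2 (noise_fun s) b k 0) ^+ 2)%:E))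
  <= (S k k)%:E)%E.
Proof.
move=> bk; rewrite /S SigmaSI_diag.
set al := (invmx _ *m block_mx a1 _ _ _) k (lshift 1 0).
set be := (invmx _ *m block_mx a1 _ _ _) k (rshift 1 0).
set MZ := invmx _ *m col_mx _ _; set MW := invmx _ *m block_mx B1 0 0 B2.
pose pl l : R * (R * R) := (MZ k l, (MW k (lshift eta l), MW k (rshift eta l))).
(* The noise coefficients of coordinate [k] of block [b], extended by zero to the whole time
   axis. *)
pose p t : R * (R * R) := if (t %/ eta == b)%N then pl (posn t) else (0, (0, 0)).
have psum (F : nat -> R * (R * R) -> R) : (forall t, F t (0, (0, 0)) = 0) ->
    \sum_(t < n) F t (p t) = \sum_(l < eta) F (b * eta + l)%N (pl l).
  move=> F0; rewrite (block_sum (F := fun t => F t (p t))); last first.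
    by move=> t kt; rewrite /p; case: eqP => // tb; rewrite tb leqNgt bk in kt.
  rewrite (bigD1 (Ordinal bk))//= [X in _ + X]big1 ?addr0.
    by apply: eq_bigr => i _; rewrite /p block_div eqxx block_posn.
  move=> b' bb'; apply: big1 => i _; rewrite /p block_div.
  by rewrite (_ : (_ == b) = false)//; apply/negbTE; rewrite -val_eqE in bb'.
have V : \sum_(l < eta) noise_var N s1 s2 rho (pl l) =
    \sum_(t < n) noise_var N s1 s2 rho (p t).
  by rewrite (psum (fun _ => noise_var N s1 s2 rho))// /noise_var /= => _; ring.
rewrite -/(pl _) V; set W := \sum_(t < n) _.
pose f (m1 : 'I_(K1 c)) (m2 : 'I_(K2 c)) :=
  (al * xi1 cb (enum_val m1) b + be * xi2 cb (enum_val m2) b) ^+ 2 + W.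
apply: le_trans (@msg_avg_le c _ f _) _.
  move=> m1 m2; apply: le_trans (@noise_expect_sqr_le R N s1 s2 rho N_gt0 rho1 n
    (al * xi1 cb (enum_val m1) b + be * xi2 cb (enum_val m2) b) p).
  apply: le_noise_expect => s; first by rewrite lee_fin sqr_ge0.
  rewrite lee_fin (psum (fun t q => noise_form q (noise_fun s t))); last first.
    by move=> t; rewrite /noise_form /=; ring.
  set e := noise_fun s.
  rewrite /block_inputs (@feedback_solution R eta a1 a2 B1 B2
    (fun i => X1 m1 m2 e (b * eta + i)) (fun i => X2 m1 m2 e (b * eta + i))
    (fun i => (e (b * eta + i)%N).1) (fun i => (e (b * eta + i)%N).2.1)
    (fun i => (e (b * eta + i)%N).2.2) (xi1 cb (enum_val m1) b) (xi2 cb (enum_val m2) b))//.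
  - by move=> i; rewrite X1_block.
  - by move=> i; rewrite X2_block.
rewrite lee_fin /f.
rewrite (_ : \sum_m1 _ = \sum_(x : {ffun J1 -> T}) \sum_(y : {ffun J2 -> T})
   ((al * xi1 cb x b + be * xi2 cb y b) ^+ 2 + W)); last first.
  rewrite [RHS](reindex_onto enum_val enum_rank) /=; last by move=> x _; rewrite enum_rankK.
  apply: eq_big => [x|x _]; first by rewrite enum_valK eqxx.
  rewrite [RHS](reindex_onto enum_val enum_rank) /=; last by move=> y _; rewrite enum_rankK.
  by apply: eq_bigl => y; rewrite enum_valK eqxx.
apply: sum_bilinear_le; [exact: card_msg_gt0|exact: card_msg_gt0|exact: sum_xi| |].
  by rewrite sum_xi_sqr// ler_piMr.
by rewrite sum_xi_sqr// ler_piMr.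
Qed.

Lemma input_power (X : 'I_(K1 c) -> 'I_(K2 c) -> (nat -> R * (R * R)) -> nat -> R)
    (side : 'I_eta -> 'I_(eta + eta)) (P : R) : (0 < n)%N ->
  (forall m1 m2 e b (i : 'I_eta), (b < kb)%N ->
     X m1 m2 e (b * eta + i)%N = block_inputs m1 m2 e b (side i) 0) ->
  (forall m1 m2 e t, (t < n)%N -> (kb <= t %/ eta)%N -> X m1 m2 e t = 0) ->
  0 < P -> \sum_i S (side i) (side i) <= eta%:R * P ->
  ((n%:R^-1)%:E * \sum_(t < n) msg_avg (c := c) (fun m1 m2 =>
     noise_expect N s1 s2 rho (fun s : n.-tuple (R * (R * R)) =>
      (X m1 m2 (noise_fun s) t ^+ 2)%:E)) <= P%:E)%E.
Proof.
move=> n0 Xb X0 P0 SP.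
pose v t : R := if (t %/ eta < kb)%N then S (side (posn t)) (side (posn t)) else 0.
apply: (@le_trans _ _ ((n%:R^-1)%:E * \sum_(t < n) (v t)%:E)%E).
  rewrite lee_wpmul2l ?lee_fin ?invr_ge0//; apply: lee_sum => t _.
  rewrite /v; case: ltnP => tk.
    have tE : t = (t %/ eta * eta + posn t)%N :> nat by rewrite -divn_eq.
    apply: le_trans (@block_power _ (side (posn t)) tk).
    rewrite lee_wpmul2l ?lee_fin ?invr_ge0 ?mulr_ge0//.
    apply: lee_sum => m1 _; apply: lee_sum => m2 _.
    apply: le_noise_expect => s; first by rewrite lee_fin sqr_ge0.
    by rewrite {1}tE Xb.
  rewrite /msg_avg big1 ?mule0// => m1 _; rewrite big1// => m2 _.
  under (@eq_fun _ _ _ _) => s do rewrite X0// expr0n /=.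
  (* The integral of the zero function is the empty sum of exponentials. *)
  have := @noise_expect_exp R N s1 s2 rho N_gt0 rho1 n nat [::] (fun=> 0) (fun _ _ => (0, (0, 0))).
  by under (@eq_fun _ _ _ _) => s do rewrite big_nil; rewrite big_nil.
rewrite sumEFin -EFinM lee_fin ler_pdivrMl ?ltr0n//.
rewrite (block_sum (F := v)); last by move=> t kt; rewrite /v ltnNge kt.
rewrite (eq_bigr (fun=> \sum_i S (side i) (side i))); last first.
  by move=> b _; apply: eq_bigr => i _; rewrite /v block_div ltn_ord block_posn.
rewrite sumr_card card_ord.
apply: le_trans (ler_wpM2l (ler0n _ _) SP) _.
rewrite mulrA -natrM ler_wpM2r ?(ltW P0)// ler_nat.
exact: leq_trunc_div.
Qed.

Lemma layered_power_ok : (0 < n)%N -> 0 < P1 -> 0 < P2 ->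
  power_params P1 P2 N s1 s2 rho a1 a2 B1 B2 -> power_ok P1 P2 N s1 s2 rho c.
Proof.
move=> n0 P10 P20 [tr1 tr2]; split.
- apply: (@input_power _ (lshift eta)) => //.
  + by move=> m1 m2 e b i bk; rewrite /block_inputs col_mxEu mxE.
  + move=> m1 m2 e t tn tk; have [-> _] := @X_rec R n c m1 m2 e t tn.
    by rewrite /= /encode ltnNge tk.
  + by apply: le_trans tr1; rewrite /mxtrace; apply: ler_sum => i _; rewrite !mxE.
- apply: (@input_power _ (@rshift eta eta)) => //.
  + by move=> m1 m2 e b i bk; rewrite /block_inputs col_mxEd mxE.
  + move=> m1 m2 e t tn tk; have [_ ->] := @X_rec R n c m1 m2 e t tn.
    by rewrite /= /encode ltnNge tk.
  + by apply: le_trans tr2; rewrite /mxtrace; apply: ler_sum => i _; rewrite !mxE.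
Qed.

End Power.

(** The error bound holds on average over codebooks, hence for one of them. [(K * 2)%:R] counts the
    codewords of a layer, negatives included. *)
Lemma exists_codebook (N s1 s2 rho vs l1 l2 : R) : 0 < N -> -1 <= rho <= 1 ->
  strictly_lower B1 -> strictly_lower B2 -> injective rk ->
  (forall j, gain j j = vs) ->
  (forall j, N * hnorm j + \sum_(j' | (rk j < rk j')%N) gain j j' ^+ 2 <= vs) ->
  0 <= l1 -> 0 <= l2 -> 0 < theta -> (0 < kb)%N ->
  exists cb, (err_prob N s1 s2 rho (layered_code cb) <=
   (#|{: J}|%:R * (expR (kb%:R * (- l1 * (vs - theta) + l1 ^+ 2 * vs / 2)) +
     (K * 2)%:R * expR (kb%:R * (- l2 * theta + l2 ^+ 2 * (vs ^+ 2 + vs) / 2))))%:E)%E.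
Proof.
move=> N0 rho1 sl1 sl2 rki gs gl l10 l20 th0 k0.
set A := expR _; set B := expR _; set E := _ * (_ + _).
pose CB := {ffun (J * 'I_K) * 'I_kb -> bool}.
pose n1 : R := #|{ffun J1 -> T}|%:R; pose n2 : R := #|{ffun J2 -> T}|%:R.
have n10 : 0 < n1 by rewrite ltr0n card_msg_gt0.
have n20 : 0 < n2 by rewrite ltr0n card_msg_gt0.
pose f (cb : CB) m1 m2 := \sum_(jx : J * T) err_mean cb N m1 m2 l1 l2 jx.
pose G (cb : CB) := (n1 * n2)^-1 * \sum_m1 \sum_m2 f cb m1 m2.
have [cb Gle] : exists cb, G cb <= E.
  apply: contrapT => /forallNP H.
  have : \sum_(cb : CB) G cb <= \sum_(cb : CB) E.
    rewrite /G -mulr_sumr mulrC ler_pdivrMr ?mulr_gt0// exchange_big/=.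
    apply: (@le_trans _ _ (\sum_(m1 < #|{ffun J1 -> T}|) \sum_(m2 < #|{ffun J2 -> T}|)
       #|CB|%:R * E)).
      apply: ler_sum => m1 _; rewrite exchange_big; apply: ler_sum => m2 _.
      rewrite /f exchange_big/=.
      apply: le_trans (ler_sum _ (fun jx _ => sum_err_mean_le rki gs gl m1 m2 l1 l2 jx)) _.
      rewrite -mulr_sumr ler_wpM2l// -/B big_split /= sumr_const card_prod card_prod.
      rewrite card_ord card_bool /E -/A [leRHS]mulrDr lerD//; last first.
        by rewrite -[leLHS]mulr_natl natrM mulrA.
      rewrite -(pair_bigA _ (fun j x => if x == layer_msg (enum_val m1) (enum_val m2) j
        then A else 0)) /=.
      rewrite (eq_bigr (fun=> A)) ?sumr_const ?mulr_natl// => j _.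
      by rewrite -big_mkcond big_pred1_eq.
    rewrite !sumr_card !card_ord /n1 /n2 le_eqVlt; apply/orP; left.
    by apply/eqP; ring.
  apply/negP; rewrite -ltNge; apply: ltr_sum.
    by apply/hasP; exists [ffun=> false]; rewrite ?mem_index_enum.
  by move=> cb _; rewrite ltNge; apply/negP; exact: H.
exists cb; apply: le_trans (@msg_avg_le (layered_code cb) _ (f cb) _) _.
  by move=> m1 m2; exact: noise_error_le.
by rewrite lee_fin.
Qed.

End LayeredCode.

(** * Splitting power into layers, and their filters *)

Section LayerGeometry.
Variable R : realType.

(** The breakpoints [u] divide the affine determinant c + u d by 1 + vs at each step, so that every
    layer has ratio [vs]. The remnant above [lo] is shorter than one step, whence [M.+1], and ln (1
    + vs) <= vs gives the last bound. *)
Lemma geometric_segment (c d hi lo vs : R) : 0 < c -> 0 <= d -> 0 <= lo <= hi -> 0 < vs ->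
  exists (M : nat) (u : nat -> R), [/\ u 0%N = hi,
    forall i, (i < M)%N -> lo <= u i.+1 <= u i /\
                          (u i - u i.+1) * d = vs * (c + u i.+1 * d) &
    ln ((c + hi * d) / (c + lo * d)) <= M.+1%:R * vs].
Proof.
move=> c0 d0 /andP[lo0 lohi] vs0.
pose D u := c + u * d.
have Dpos u : 0 <= u -> 0 < D u by move=> u0; rewrite /D ltr_pwDl// mulr_ge0.
have Dlo := Dpos _ lo0; have Dhi := Dpos _ (le_trans lo0 lohi).
have l0 : 0 < ln (1 + vs) by rewrite ln_gt0// ltrDl.
pose x := ln (D hi / D lo) / ln (1 + vs).
have x0 : 0 <= x.
  apply: divr_ge0 (ltW l0); apply: ln_ge0.
  by rewrite ler_pdivlMr// mul1r /D lerD2l ler_wpM2r.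
pose M := Num.truncn x.
pose u i : R := if i is 0%N then hi else (D hi / (1 + vs) ^+ i - c) / d.
have /andP[Mx xM] := truncn_itv x0.
have vs1 : 0 < 1 + vs by lra.
have Mlast : ln (D hi / D lo) <= M.+1%:R * vs.
  apply: (@le_trans _ _ (M.+1%:R * ln (1 + vs))).
    by rewrite -ler_pdivrMr// ltW.
  by rewrite ler_wpM2l// le_ln1Dx// (lt_trans _ vs0)// ltrN10.
exists M, u; split => // i iM.
(* If [d] were 0, the determinant ratio would be 1 and [M] would be 0, leaving no step [i]. *)
have dn0 : d != 0.
  apply/eqP => dz; move: iM; rewrite /M /x /D dz !mulr0 !addr0 divff ?gt_eqF//.
  by rewrite ln1 mul0r truncn0.
have dp : 0 < d by rewrite lt_neqAle eq_sym dn0.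
have pw k : 0 < (1 + vs) ^+ k by rewrite exprn_gt0.
have uE k : D (u k) = D hi / (1 + vs) ^+ k.
  case: k => [|k]; first by rewrite expr0 divr1.
  by rewrite /D /u divfK// addrC subrK.
have Ddiff : D (u i) = (1 + vs) * D (u i.+1).
  rewrite !uE exprS; field; apply/andP; split; first by rewrite gt_eqF.
  by rewrite gt_eqF.
have Dge : D lo <= D (u i.+1).
  rewrite uE ler_pdivlMr// mulrC -ler_pdivlMr//.
  rewrite -ler_ln ?posrE ?divr_gt0// lnXn// -mulr_natl.
  rewrite -ler_pdivlMr//; apply: le_trans Mx; rewrite ler_nat.
  exact: iM.
have lou : lo <= u i.+1 by move: Dge; rewrite /D lerD2l ler_pM2r.
have E : (u i - u i.+1) * d = vs * (c + u i.+1 * d).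
  by move: Ddiff; rewrite /D; lra.
split => //; rewrite lou -subr_ge0 -(pmulr_lge0 _ dp) E mulr_ge0 ?(ltW vs0)//.
exact/ltW/Dpos/(le_trans lo0).
Qed.

Variable eta : nat.
Implicit Types u v a b f : 'cV[R]_eta.

Definition dotv u v : R := \sum_(i < eta) u i 0 * v i 0.

Lemma dotvC u v : dotv u v = dotv v u.
Proof. by apply: eq_bigr => i _; rewrite mulrC. Qed.

Lemma dotvDl u v w : dotv (u + v) w = dotv u w + dotv v w.
Proof. by rewrite -big_split; apply: eq_bigr => i _; rewrite mxE mulrDl. Qed.

Lemma dotvZl k u w : dotv (k *: u) w = k * dotv u w.
Proof. by rewrite mulr_sumr; apply: eq_bigr => i _; rewrite mxE mulrA. Qed.

Lemma dotv_ge0 u : 0 <= dotv u u.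
Proof. by apply: sumr_ge0 => i _; rewrite -expr2 sqr_ge0. Qed.

Definition self_gain (p q g v : R) := p * (1 + v * q) - v * g ^+ 2.

(* The MMSE filter for a layer of the user with direction [a]: interference
   amounts to noise [N], a fraction [u] of the same user and a fraction [v] of
   the other one, and [1 + v * q + u * self_gain p q g v] is the determinant of
   the total covariance divided by that of the noise. *)
Lemma layer_filter (N p q g s u v vs : R) a b fa fb :
  0 < N -> 0 < vs -> 0 < 1 + v * q + u * self_gain p q g v ->
  dotv fa fa = N * p -> dotv fa fb = N * g -> dotv fb fb = N * q ->
  dotv fa a = N * p -> dotv fa b = N * g -> dotv fb a = N * g -> dotv fb b = N * q ->
  s ^+ 2 * self_gain p q g v = vs * (1 + v * q + u * self_gain p q g v) ->
  exists f, dotv f (s *: a) = vs /\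
    forall U V, U <= u -> V <= v ->
      N * dotv f f + (dotv f a ^+ 2 * U + dotv f b ^+ 2 * V) <= vs.
Proof.
move=> N0 vs0 D0 ffa fab ffb faa fab' fba fbb sE.
set d := self_gain p q g v in D0 sE *; set D := 1 + v * q + u * d in D0 sE *.
have Nn := lt0r_neq0 N0; have Dn := lt0r_neq0 D0.
pose k := s / (N * D).
(* By Sherman-Morrison this is proportional to (I + (v / N) fb fb^T)^-1 fa. Interference from the
   same user changes only the scale, and [k] normalises the gain to [vs]. *)
pose f := k *: ((1 + v * q) *: fa + (- (v * g)) *: fb).
have fa_ : dotv f a = k * (N * d).
  by rewrite /f dotvZl dotvDl !dotvZl faa fba /d /self_gain; ring.
have fb_ : dotv f b = k * (N * g).
  by rewrite /f dotvZl dotvDl !dotvZl fab' fbb; ring.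
have ff_ : dotv f f = k ^+ 2 * N *
    ((1 + v * q) ^+ 2 * p - 2 * (1 + v * q) * v * g ^+ 2 + v ^+ 2 * g ^+ 2 * q).
  rewrite {1}/f dotvZl dotvDl !dotvZl ![dotv _ f]dotvC /f !dotvZl !dotvDl !dotvZl.
  by rewrite ffa ffb [dotv fb fa]dotvC fab; ring.
have kE : k ^+ 2 * N ^+ 2 * d * D = vs.
  rewrite (_ : _ * D = s ^+ 2 * d / D); last by rewrite /k; field; apply/andP.
  by rewrite sE mulfK.
exists f; split.
  rewrite dotvC dotvZl dotvC fa_.
  rewrite (_ : _ * _ = s ^+ 2 * d / D); last by rewrite /k; field; apply/andP.
  by rewrite sE mulfK.
move=> U V Uu Vv; rewrite -[leRHS]kE ff_ fa_ fb_.
apply: (@le_trans _ _ (N * (k ^+ 2 * N *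
    ((1 + v * q) ^+ 2 * p - 2 * (1 + v * q) * v * g ^+ 2 + v ^+ 2 * g ^+ 2 * q)) +
    ((k * (N * d)) ^+ 2 * u + (k * (N * g)) ^+ 2 * v))).
  by rewrite lerD2l lerD// ler_wpM2l ?sqr_ge0.
by rewrite le_eqVlt; apply/orP; left; apply/eqP; rewrite /D /d /self_gain; ring.
Qed.

End LayerGeometry.

(** The decoding order: [MA] layers of user 2, then all [MB] layers of user 1, then the [MC] other
    layers of user 2. User 1 is the left summand. *)
Definition rank3 (MA MB MC : nat) (j : 'I_MB + ('I_MA + 'I_MC)) : nat :=
  match j with
  | inl i => MA + i | inr (inl i) => i | inr (inr i) => MA + MB + i
  end%N.

Lemma rank3_inj (MA MB MC : nat) : injective (@rank3 MA MB MC).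
Proof.
move=> [i|[i|i]] [j|[j|j]] /= E; have ii := ltn_ord i; have jj := ltn_ord j;
  try (by exfalso; lia).
- by congr (inl _); apply/val_inj => /=; lia.
- by congr (inr (inl _)); apply/val_inj.
- by congr (inr (inr _)); apply/val_inj => /=; lia.
Qed.

(** * Interleaving the layers of the two users *)

Section Layers.
Variables (R : realType) (eta : nat) (N p1 p2 g v0 vs : R).
Variables (a1 a2 f1 f2 : 'cV[R]_eta).
Hypotheses (N_gt0 : 0 < N) (p1_ge0 : 0 <= p1) (p2_ge0 : 0 <= p2).
Hypotheses (cauchy : g ^+ 2 <= p1 * p2) (v0_itv : 0 <= v0 <= 1) (vs_gt0 : 0 < vs).
Hypotheses (ff11 : dotv f1 f1 = N * p1) (ff12 : dotv f1 f2 = N * g)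
  (ff22 : dotv f2 f2 = N * p2) (fa11 : dotv f1 a1 = N * p1)
  (fa12 : dotv f1 a2 = N * g) (fa21 : dotv f2 a1 = N * g) (fa22 : dotv f2 a2 = N * p2).

(** The ratio of covariance determinants when fractions [u] and [v] of the powers of users 1 and 2
    are present. *)
Definition cov_det (u v : R) := (1 + u * p1) * (1 + v * p2) - u * v * g ^+ 2.

Lemma sum_tail (M k : nat) (u : nat -> R) : (k <= M)%N ->
  \sum_(i < M | (k <= i)%N) (u i - u i.+1) = u k - u M.
Proof.
move=> kM; rewrite -(big_geq_mkord k M xpredT (fun i => u i - u i.+1)) /=.
under eq_bigr do rewrite -opprB.
by rewrite sumrN telescope_sumr// opprB.
Qed.

(** The undecoded fractions (u, v) run from (1, 1) to (1, v0), then to (0, v0) and to (0, 0). On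
    each edge [cov_det] is affine in the moving coordinate, with slopes [dA], [dB], [dC], so
    [geometric_segment] applies. User 2 owns two edges, each wasting less than one layer, whence the
    2. *)
Lemma exists_layers : exists (J1 J2 : finType) (rk : J1 + J2 -> nat)
    (amp : J1 + J2 -> R) (h : J1 + J2 -> 'cV[R]_eta),
  [/\ injective rk,
      forall j, gain a1 a2 amp h j j = vs,
      forall j, N * hnorm h j +
        \sum_(j' | (rk j < rk j')%N) gain a1 a2 amp h j j' ^+ 2 <= vs,
      \sum_j amp (inl j) ^+ 2 <= 1 & \sum_j amp (inr j) ^+ 2 <= 1] /\
  ln (cov_det 1 v0 / cov_det 0 v0) <= (#|J1|%:R + 2) * vs /\
  ln (cov_det 1 1 / cov_det 1 v0) + ln (cov_det 0 v0) <= (#|J2|%:R + 2) * vs.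
Proof.
have /andP[v00 v01] := v0_itv; have p10 := p1_ge0; have p20 := p2_ge0.
pose dA := self_gain p2 p1 g 1; pose dB := self_gain p1 p2 g v0.
pose dC := self_gain p2 p1 g 0.
have dA0 : 0 <= dA.
  rewrite (_ : dA = p2 + (p1 * p2 - g ^+ 2)); last by rewrite /dA /self_gain; ring.
  by rewrite addr_ge0// subr_ge0.
have dB0 : 0 <= dB.
  rewrite (_ : dB = p1 + v0 * (p1 * p2 - g ^+ 2)); last by rewrite /dB /self_gain; ring.
  by rewrite addr_ge0// mulr_ge0// subr_ge0.
have dC0 : 0 <= dC by rewrite /dC /self_gain !mul0r subr0 addr0 mulr1.
have cA0 : 0 < 1 + 1 * p1 by lra.
have cB0 : 0 < 1 + v0 * p2 by rewrite ltr_pwDl// mulr_ge0.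
have cC0 : 0 < 1 + 0 * p1 by lra.
have [MA [uA [uA0 uAP lnA]]] := geometric_segment cA0 dA0 v0_itv vs_gt0.
have i01 : 0 <= (0 : R) <= 1 by rewrite lexx ler01.
have [MB [uB [uB0 uBP lnB]]] := geometric_segment cB0 dB0 i01 vs_gt0.
have i0v : 0 <= (0 : R) <= v0 by rewrite lexx.
have [MC [uC [uC0 uCP lnC]]] := geometric_segment cC0 dC0 i0v vs_gt0.
have uAM : v0 <= uA MA.
  by case: MA uAP {lnA} => [|m] H; [rewrite uA0|have [/andP[]] := H m (ltnSn m)].
have uBM : 0 <= uB MB.
  by case: MB uBP {lnB} => [|m] H; [rewrite uB0|have [/andP[]] := H m (ltnSn m)].
have uCM : 0 <= uC MC.
  by case: MC uCP {lnC} => [|m] H; [rewrite uC0|have [/andP[]] := H m (ltnSn m)].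
pose JJ : Type := ('I_MB + ('I_MA + 'I_MC))%type.
pose rk : JJ -> nat := @rank3 MA MB MC.
pose w (j : JJ) : R := match j with
  | inl i => uB i - uB i.+1 | inr (inl i) => uA i - uA i.+1
  | inr (inr i) => uC i - uC i.+1 end.
have w0 j : 0 <= w j.
  by case: j => [i|[i|i]] /=; rewrite subr_ge0;
    [have [/andP[]] := uBP i (ltn_ord i)|have [/andP[]] := uAP i (ltn_ord i)
    |have [/andP[]] := uCP i (ltn_ord i)].
pose amp j := Num.sqrt (w j).
have amp2 j : amp j ^+ 2 = w j by rewrite sqr_sqrtr.
have gainE h j j' : gain a1 a2 amp h j j' = amp j' * dotv (h j)
    (match j' with inl _ => a1 | inr _ => a2 end).
  by rewrite dotvC -dotvZl dotvC.
have hnormE h (j : JJ) : hnorm h j = dotv (h j) (h j).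
  by apply: eq_bigr => i _; rewrite expr2.
(* The powers of later layers telescope to at most the nominal undecoded fractions. Remnants of the
   edges carry no layer, so [layer_filter] allows any smaller [U] and [V]. *)
pose later1 j : R := \sum_(i | (rk j < rk (inl i))%N) w (inl i).
pose later2 j : R := \sum_(i | (rk j < rk (inr i))%N) w (inr i).
pose aof (j : JJ) := match j with inl _ => a1 | inr _ => a2 end.
have laterE f j : \sum_(j' | (rk j < rk j')%N) (amp j' * dotv f (aof j')) ^+ 2 =
    dotv f a1 ^+ 2 * later1 j + dotv f a2 ^+ 2 * later2 j.
  rewrite big_mkcond big_sumType /= -!big_mkcond /= /later1 /later2 !mulr_sumr.
  by congr (_ + _); apply: eq_bigr => i _; rewrite exprMn amp2 mulrC.
have filt j : exists f, amp j * dotv f (aof j) = vs /\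
    N * dotv f f + (dotv f a1 ^+ 2 * later1 j + dotv f a2 ^+ 2 * later2 j) <= vs.
  case: j => [i|[i|i]].
  - have [/andP[lo le] E] := uBP i (ltn_ord i).
    have D0 : 0 < 1 + v0 * p2 + uB i.+1 * dB by rewrite ltr_pwDl// mulr_ge0.
    have sE : amp (inl i) ^+ 2 * dB = vs * (1 + v0 * p2 + uB i.+1 * dB) by rewrite amp2.
    have [f [fs fl]] := layer_filter N_gt0 vs_gt0 D0 ff11 ff12 ff22 fa11 fa12 fa21 fa22 sE.
    exists f; split; first by rewrite -fs [RHS]dotvC dotvZl dotvC.
    apply: fl.
      rewrite /later1 /= (eq_bigl (fun i' : 'I_MB => (i.+1 <= i')%N)); last first.
        by move=> i'; rewrite /= ltn_add2l.
      by rewrite sum_tail//; lra.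
    rewrite /later2 big_mkcond big_sumType /= -!big_mkcond /= big1 ?add0r.
      rewrite (eq_bigl (fun i' : 'I_MC => (0 <= i')%N)); last first.
        by move=> i'; rewrite /= -addnA ltn_add2l ltn_addr.
      by rewrite sum_tail//; lra.
    by move=> i'; rewrite ltnNge ltnW// ltn_addr.
  - have [/andP[lo le] E] := uAP i (ltn_ord i).
    have ff21 : dotv f2 f1 = N * g by rewrite dotvC.
    have D0 : 0 < 1 + 1 * p1 + uA i.+1 * dA by rewrite ltr_pwDl// mulr_ge0 ?(le_trans v00 lo).
    have sE : amp (inr (inl i)) ^+ 2 * dA = vs * (1 + 1 * p1 + uA i.+1 * dA) by rewrite amp2.
    have [f [fs fl]] := layer_filter N_gt0 vs_gt0 D0 ff22 ff21 ff11 fa22 fa21 fa12 fa11 sE.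
    exists f; split; first by rewrite -fs [RHS]dotvC dotvZl dotvC.
    rewrite [X in _ + X]addrC; apply: fl.
      rewrite /later2 big_mkcond big_sumType /= -!big_mkcond /= sum_tail//.
      rewrite (eq_bigl (fun i' : 'I_MC => (0 <= i')%N)); last first.
        by move=> i'; rewrite /= -addnA ltn_addr.
      by rewrite sum_tail//; lra.
    rewrite /later1 (eq_bigl (fun i' : 'I_MB => (0 <= i')%N)); last first.
      by move=> i'; rewrite /= ltn_addr.
    by rewrite sum_tail//; lra.
  - have [/andP[lo le] E] := uCP i (ltn_ord i).
    have ff21 : dotv f2 f1 = N * g by rewrite dotvC.
    have D0 : 0 < 1 + 0 * p1 + uC i.+1 * dC by rewrite ltr_pwDl// mulr_ge0.
    have sE : amp (inr (inr i)) ^+ 2 * dC = vs * (1 + 0 * p1 + uC i.+1 * dC) by rewrite amp2.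
    have [f [fs fl]] := layer_filter N_gt0 vs_gt0 D0 ff22 ff21 ff11 fa22 fa21 fa12 fa11 sE.
    exists f; split; first by rewrite -fs [RHS]dotvC dotvZl dotvC.
    rewrite [X in _ + X]addrC; apply: fl.
      rewrite /later2 big_mkcond big_sumType /= -!big_mkcond /= big1 ?add0r.
        rewrite (eq_bigl (fun i' : 'I_MC => (i.+1 <= i')%N)); last first.
          by move=> i'; rewrite /= ltn_add2l.
        by rewrite sum_tail//; lra.
      by move=> i'; rewrite ltnNge -addnA ltnW// ltn_addr.
    rewrite /later1 big1// => i'; rewrite ltnNge /= -addnA leq_add2l.
    by rewrite ltnW// ltn_addr.
have [h hP] := choice filt.
exists 'I_MB, ('I_MA + 'I_MC)%type, rk, amp, h; split; last split.
- split.
  + exact: rank3_inj.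
  + by move=> j; rewrite gainE; case: (hP j).
  + move=> j; rewrite hnormE; have [_] := hP j; rewrite -laterE.
    by under [in leLHS]eq_bigr do rewrite -gainE.
  + under eq_bigr do rewrite amp2 /=.
    by rewrite (@sum_tail MB 0)//; lra.
  + under eq_bigr do rewrite amp2.
    rewrite big_sumType /= (@sum_tail MA 0)// (@sum_tail MC 0)//; lra.
- rewrite card_ord.
  rewrite (_ : cov_det 1 v0 = 1 + v0 * p2 + 1 * dB); last by rewrite /cov_det /dB /self_gain; ring.
  rewrite (_ : cov_det 0 v0 = 1 + v0 * p2 + 0 * dB); last by rewrite /cov_det; ring.
  apply: le_trans lnB _; rewrite ler_wpM2r ?(ltW vs_gt0)// -natr1; lra.
rewrite card_sum !card_ord.
rewrite (_ : cov_det 1 1 = 1 + 1 * p1 + 1 * dA); last by rewrite /cov_det /dA /self_gain; ring.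
rewrite (_ : cov_det 1 v0 = 1 + 1 * p1 + v0 * dA); last by rewrite /cov_det /dA /self_gain; ring.
rewrite (_ : cov_det 0 v0 = (1 + 0 * p1 + v0 * dC) / (1 + 0 * p1 + 0 * dC)); last first.
  by rewrite /cov_det /dC /self_gain; field.
apply: le_trans (lerD lnA lnC) _; rewrite -mulrDl ler_wpM2r ?(ltW vs_gt0)//.
by rewrite -!natr1 natrD; lra.
Qed.

End Layers.

(** * Rate bounds as small Gram determinants *)

Section RateBound.
Variables (R : realType) (N : R) (eta k : nat) (D : 'M[R]_(k, eta)).
Hypotheses (N_gt0 : 0 < N) (DD : \det (D *m D^T) != 0).

(** Sylvester's identity: the two products evaluate the determinant of the same block matrix. *)
Lemma det_1D_mulC m l (X : 'M[R]_(m, l)) (Y : 'M[R]_(l, m)) :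
  \det (1%:M + X *m Y) = \det (1%:M + Y *m X).
Proof.
have E1 : block_mx 1%:M (- X) Y 1%:M *m block_mx 1%:M X 0 1%:M =
    block_mx 1%:M 0 Y (1%:M + Y *m X).
  rewrite mulmx_block !(mulmx1, mulmx0, mul1mx, addr0).
  by rewrite subrr addrC.
have E2 : block_mx 1%:M X 0 1%:M *m block_mx 1%:M (- X) Y 1%:M =
    block_mx (1%:M + X *m Y) 0 Y 1%:M.
  rewrite mulmx_block !(mulmx1, mul0mx, mul1mx, add0r).
  by rewrite addNr.
have := congr1 determinant E1; have := congr1 determinant E2.
by rewrite !det_mulmx det_ublock !det_lblock !det1 !mul1r !mulr1 => -> ->.
Qed.

(** The orthogonal projection onto the row space of [D], the only feature of [D] on which the rate
    bounds depend. *)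
Definition rowproj : 'M[R]_eta := D^T *m invmx (D *m D^T) *m D.

Lemma DD_unit : D *m D^T \in unitmx.
Proof. by rewrite unitmxE unitfE. Qed.

Lemma rowproj_sym : rowproj^T = rowproj.
Proof. by rewrite /rowproj !trmx_mul trmxK trmx_inv trmx_mul trmxK mulmxA. Qed.

Lemma rowproj_idem : rowproj *m rowproj = rowproj.
Proof.
rewrite /rowproj -!mulmxA (mulmxA D D^T); congr (_ *m _).
by rewrite (mulmxA (D *m D^T)) mulmxV ?DD_unit// mul1mx.
Qed.

Lemma dotv_mx (u v : 'cV[R]_eta) : dotv u v = (u^T *m v) 0 0.
Proof. by rewrite mxE; apply: eq_bigr => i _; rewrite mxE. Qed.

Lemma dotv_proj (u v : 'cV[R]_eta) : dotv (rowproj *m u) v = (u^T *m rowproj *m v) 0 0.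
Proof. by rewrite dotv_mx trmx_mul rowproj_sym. Qed.

Lemma dotv_projr (u v : 'cV[R]_eta) :
  dotv (rowproj *m u) (rowproj *m v) = dotv (rowproj *m u) v.
Proof. by rewrite !dotv_proj mulmxA -(mulmxA u^T) rowproj_idem. Qed.

Lemma rate_bound_det m (S : 'M[R]_(eta, m)) :
  rate_bound N D (S *m S^T) =
  (2 * eta%:R)^-1 * ln (\det (1%:M + N^-1 *: (S^T *m rowproj *m S))).
Proof.
rewrite /rate_bound; congr (_ * ln _).
have Nn := lt0r_neq0 N_gt0.
have -> : D *m (S *m S^T + N%:M) *m D^T = (N *: (D *m D^T)) *m
    (1%:M + (N^-1 *: (invmx (D *m D^T) *m D *m S)) *m (S^T *m D^T)).
  rewrite [RHS]mulmxDr mulmx1 [D *m _]mulmxDr [LHS]mulmxDl [LHS]addrC mul_mx_scalar -scalemxAl; congr (_ + _).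
    by rewrite scalemxAl.
  rewrite -scalemxAl -scalemxAr scalerA mulfV// scale1r.
  by rewrite !mulmxA mulmxV ?DD_unit// mul1mx.
rewrite det_mulmx mulrAC divff ?mul1r.
  by rewrite det_1D_mulC -scalemxAr /rowproj !mulmxA.
by rewrite detZ mulf_neq0// expf_neq0.
Qed.

Lemma rate_bound1 (a : 'cV[R]_eta) : rate_bound N D (a *m a^T) =
  (2 * eta%:R)^-1 * ln (1 + N^-1 * dotv (rowproj *m a) a).
Proof.
rewrite rate_bound_det det_mx11 !mxE dotv_proj mxE; congr (_ * ln (_ + _)).
Qed.

Lemma det_mx2 (A : 'M[R]_(1 + 1)) (l := lshift 1 0) (r := rshift 1 0) :
  \det A = A l l * A r r - A l r * A r l.
Proof.
rewrite (expand_det_row _ l) big_split_ord /= !big_ord1 /cofactor !det_mx11 !mxE /=.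
rewrite expr0 expr1 mul1r mulN1r mulrN.
by congr (A _ _ * A _ _ - A _ _ * A _ _); apply/val_inj.
Qed.

Lemma rate_bound2 (a1 a2 : 'cV[R]_eta) :
  rate_bound N D (row_mx a1 a2 *m (row_mx a1 a2)^T) =
  (2 * eta%:R)^-1 * ln ((1 + N^-1 * dotv (rowproj *m a1) a1) *
     (1 + N^-1 * dotv (rowproj *m a2) a2) - (N^-1 * dotv (rowproj *m a1) a2) ^+ 2).
Proof.
rewrite rate_bound_det tr_row_mx mul_col_mx mul_col_row; congr (_ * ln _).
have sym : dotv (rowproj *m a2) a1 = dotv (rowproj *m a1) a2.
  by rewrite -dotv_projr dotvC dotv_projr.
rewrite expr2 -{2}sym !dotv_proj scalar_mx_block scale_block_mx add_block_mx.
by rewrite det_mx2 block_mxEul block_mxEur block_mxEdl block_mxEdr !mxE eqxx mulr1n !add0r; ring.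
Qed.

Lemma dotv_cauchy (f1 f2 : 'cV[R]_eta) :
  dotv f1 f2 ^+ 2 <= dotv f1 f1 * dotv f2 f2.
Proof.
set g := dotv f1 f2; set p := dotv f1 f1; set q := dotv f2 f2.
have H x y : 0 <= x ^+ 2 * p + 2 * x * y * g + y ^+ 2 * q.
  have := dotv_ge0 (x *: f1 + y *: f2).
  rewrite dotvDl !dotvZl ![dotv _ (_ + _)]dotvC !dotvDl !dotvZl.
  by rewrite [dotv f2 f1]dotvC -/g -/p -/q; lra.
have q0 : 0 <= q by exact: dotv_ge0.
have [q1|q1] := ltP 0 q; first by have := H q (- g); nra.
have qz : q = 0 by lra.
(* When q = 0 these weights turn the nonnegative form into - g^2, forcing g = 0. *)
have := H (- g) ((p + 1) / 2); have := H (-1) g; rewrite qz; nra.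
Qed.

End RateBound.

(** * Choice of parameters and limit of large blocklength *)

Section Achievability.
Variables (R : realType) (P1 P2 N s1 s2 rho : R).
Hypotheses (P1_gt0 : 0 < P1) (P2_gt0 : 0 < P2) (N_gt0 : 0 < N) (rho1 : -1 <= rho <= 1).
Variables (eta : nat) (eta_gt0 : (0 < eta)%N) (a1 a2 : 'cV[R]_eta) (B1 B2 : 'M[R]_eta).
Hypotheses (slB1 : strictly_lower B1) (slB2 : strictly_lower B2).
Hypothesis pw : power_params P1 P2 N s1 s2 rho a1 a2 B1 B2.

Lemma ln_card_msg (I : finType) (K : nat) (x : R) : expR x <= (K * 2)%:R ->
  #|I|%:R * x <= ln (#|{ffun I -> 'I_K * bool}|%:R : R).
Proof.
move=> xK; have K0 : 0 < (K * 2)%:R :> R by apply: lt_le_trans xK; exact: expR_gt0.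
rewrite card_ffun card_prod card_ord card_bool natrX lnXn// -[leRHS]mulr_natl ler_wpM2l//.
by rewrite -ler_expR lnK.
Qed.

Lemma layered_codes (J1 J2 : finType) (rk : J1 + J2 -> nat) (amp : J1 + J2 -> R)
    (h : J1 + J2 -> 'cV[R]_eta) (vs r theta : R) :
  injective rk -> (forall j, gain a1 a2 amp h j j = vs) ->
  (forall j, N * hnorm h j +
     \sum_(j' | (rk j < rk j')%N) gain a1 a2 amp h j j' ^+ 2 <= vs) ->
  \sum_j amp (inl j) ^+ 2 <= 1 -> \sum_j amp (inr j) ^+ 2 <= 1 ->
  0 < theta < vs -> 0 <= r ->
  forall n, exists c : code R n, (0 < n %/ eta)%N ->
   [/\ power_ok P1 P2 N s1 s2 rho c,
    #|J1|%:R * ((n %/ eta)%:R * r) <= ln (K1 c)%:R,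
    #|J2|%:R * ((n %/ eta)%:R * r) <= ln (K2 c)%:R &
    (err_prob N s1 s2 rho c <= (#|{: J1 + J2}|%:R *
      (expR (- ((n %/ eta)%:R * ((vs - theta) ^+ 2 / (2 * vs)))) + 2 *
       expR (- ((n %/ eta)%:R * (theta ^+ 2 / (2 * (vs ^+ 2 + vs)) - r)))))%:E)%E].
Proof.
move=> rki gs gl am1 am2 /andP[th0 thvs] r0 n.
have vs0 : 0 < vs by exact: lt_trans thvs.
set kb := (n %/ eta)%N; set X := expR (kb%:R * r).
have X1 : 1 <= X by rewrite -[1]expR0 ler_expR mulr_ge0.
(* Rounding down costs no rate: [X] is at least 1, so doubling the codebook by negation brings its
   size back above [X]. *)
pose K := Num.truncn X.
have /andP[KX XK] : K%:R <= X < K.+1%:R by apply: truncn_itv; exact: expR_ge0.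
have K0 : (0 < K)%N by rewrite lt0n; apply/eqP => Kz; move: XK; rewrite Kz ltNge X1.
have K2X : X <= (K * 2)%:R.
  by rewrite (le_trans (ltW XK))// ler_nat muln2 -addnn -addn1 leq_add2l.
pose code_of := @layered_code R eta eta_gt0 a1 a2 B1 B2 J1 J2 rk amp h theta n K K0.
case: (posnP kb) => [kb0|kb0]; first by exists (code_of [ffun=> false]).
(* The minimisers of the two quadratic Chernoff exponents. *)
pose l1 := (vs - theta) / vs; pose l2 := theta / (vs ^+ 2 + vs).
have vv0 : 0 < vs ^+ 2 + vs by rewrite addr_gt0// exprn_gt0.
have l10 : 0 <= l1 by rewrite divr_ge0 ?(ltW vs0)// subr_ge0 ltW.
have l20 : 0 <= l2 by rewrite divr_ge0 ?(ltW vv0)// ltW.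
have [cb cbP] := @exists_codebook R eta eta_gt0 a1 a2 B1 B2 J1 J2 rk amp h theta n K K0
  N s1 s2 rho vs l1 l2 N_gt0 rho1 slB1 slB2 rki gs gl l10 l20 th0 kb0.
exists (code_of cb) => _; split.
- apply: layered_power_ok => //.
  by move: kb0; rewrite /kb divn_gt0// => /(leq_trans eta_gt0).
- exact: ln_card_msg.
- exact: ln_card_msg.
- apply: le_trans cbP _; rewrite lee_fin ler_wpM2l// lerD//.
    rewrite ler_expR /l1 le_eqVlt; apply/orP; left; apply/eqP.
    by rewrite -/kb; field; rewrite gt_eqF.
  rewrite (_ : expR (- _) = X * expR (- (kb%:R * (theta ^+ 2 / (2 * (vs ^+ 2 + vs)))))); last first.
    by rewrite -expRD; congr expR; ring.
  rewrite (_ : expR (_ * (- l2 * _ + _)) =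
    expR (- (kb%:R * (theta ^+ 2 / (2 * (vs ^+ 2 + vs)))))); last first.
    by congr expR; rewrite -/kb /l2; field; rewrite gt_eqF.
  set E := expR _; have := ler_wpM2r (expR_ge0 _ : 0 <= E) KX.
  by rewrite natrM; lra.
Qed.

Lemma blocks_large (C : R) : exists n0 : nat, forall n, (n0 <= n)%N ->
  (0 < n %/ eta)%N /\ C < (n %/ eta)%:R.
Proof.
exists ((Num.truncn `|C|).+1 * eta)%N => n; rewrite -leq_divRL// => Cn.
split; first exact: leq_trans Cn.
apply: le_lt_trans (ler_norm C) _.
have /andP[_ /lt_le_trans] : (Num.truncn `|C|)%:R <= `|C| < (Num.truncn `|C|).+1%:R.
  exact: truncn_itv.
by apply; rewrite ler_nat.
Qed.

Lemma rate_large (c r : R) : 0 <= c -> r < c / eta%:R ->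
  exists n0 : nat, forall n, (n0 <= n)%N ->
    forall L : R, c * (n %/ eta)%:R <= L -> r < n%:R^-1 * L.
Proof.
move=> c0 rc; have e0 : 0 < eta%:R :> R by rewrite ltr0n.
have D0 : 0 < c - r * eta%:R by rewrite subr_gt0 -ltr_pdivlMr.
have [n0 n0P] := blocks_large (r * eta%:R / (c - r * eta%:R)).
exists n0 => n /n0P[kb0 kbC] L cL.
have n_gt0 : (0 < n)%N by move: kb0; rewrite divn_gt0// => /(leq_trans eta_gt0).
rewrite ltr_pdivlMl ?ltr0n//; apply: lt_le_trans cL.
move: kbC; rewrite ltr_pdivrMr// => kbC.
have [r0|r0] := leP 0 r; last first.
  by apply: (@lt_le_trans _ _ 0); rewrite ?nmulr_llt0 ?nmulr_rlt0 ?ltr0n ?mulr_ge0.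
have nk : n%:R <= ((n %/ eta)%:R + 1) * eta%:R :> R.
  by rewrite natr1 -natrM ler_nat ltnW// ltn_ceil.
apply: le_lt_trans (_ : ((n %/ eta)%:R + 1) * eta%:R * r < _); first by rewrite ler_wpM2r.
by lra.
Qed.

Lemma layered_achievable (J1 J2 : finType) (rk : J1 + J2 -> nat) (amp : J1 + J2 -> R)
    (h : J1 + J2 -> 'cV[R]_eta) (vs r R1 R2 : R) :
  injective rk -> (forall j, gain a1 a2 amp h j j = vs) ->
  (forall j, N * hnorm h j +
     \sum_(j' | (rk j < rk j')%N) gain a1 a2 amp h j j' ^+ 2 <= vs) ->
  \sum_j amp (inl j) ^+ 2 <= 1 -> \sum_j amp (inr j) ^+ 2 <= 1 ->
  0 < vs -> 0 <= r -> r < vs / (2 * (1 + vs)) ->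
  R1 < #|J1|%:R * r / eta%:R -> R2 < #|J2|%:R * r / eta%:R ->
  exists (n0 : nat) (cs : forall n : nat, code R n),
    (forall n : nat, (n0 <= n)%N ->
       [/\ power_ok P1 P2 N s1 s2 rho (cs n),
           R1 < n%:R^-1 * ln (K1 (cs n))%:R &
           R2 < n%:R^-1 * ln (K2 (cs n))%:R]) /\
    (forall eps : R, 0 < eps -> exists N0 : nat, forall n : nat, (N0 <= n)%N ->
       (err_prob N s1 s2 rho (cs n) <= eps%:E)%E).
Proof.
move=> rki gs gl am1 am2 vs0 r0 rvs R1r R2r.
have vv0 : 0 < 2 * (vs ^+ 2 + vs) by rewrite mulr_gt0// addr_gt0// exprn_gt0.
pose q := r * (2 * (vs ^+ 2 + vs)).
have q0 : 0 <= q by rewrite mulr_ge0// ltW.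
have qvs : q < vs ^+ 2.
  rewrite /q -ltr_pdivlMr//; apply: lt_le_trans rvs _.
  rewrite le_eqVlt; apply/orP; left; apply/eqP; field.
  by apply/andP; split; [rewrite gt_eqF//; lra|rewrite gt_eqF//; lra].
(* The error exponents require theta^2 > q and theta < vs. The rate condition says exactly that q <
   vs^2, and the midpoint of these squares is taken. *)
pose theta := Num.sqrt ((q + vs ^+ 2) / 2).
have th2 : theta ^+ 2 = (q + vs ^+ 2) / 2 by rewrite sqr_sqrtr//; nra.
have th0 : 0 < theta by rewrite sqrtr_gt0; nra.
have thvs : theta < vs by rewrite -ltr_sqr ?nnegrE ?(ltW vs0) ?(ltW th0)// th2; lra.
have th : 0 < theta < vs by rewrite th0.
pose E1 := (vs - theta) ^+ 2 / (2 * vs).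
pose E2 := theta ^+ 2 / (2 * (vs ^+ 2 + vs)) - r.
have E10 : 0 < E1 by rewrite divr_gt0 ?exprn_gt0 ?subr_gt0// mulr_gt0.
have E20 : 0 < E2 by rewrite subr_gt0 ltr_pdivlMr// th2 -/q; lra.
pose m := Num.min E1 E2.
have m0 : 0 < m by rewrite lt_min E10.
have H := layered_codes rki gs gl am1 am2 th r0.
pose cs n := projT1 (cid (H n)).
have csP n := projT2 (cid (H n)).
have [n1 n1P] := rate_large (mulr_ge0 (ler0n R #|J1|) r0) R1r.
have [n2 n2P] := rate_large (mulr_ge0 (ler0n R #|J2|) r0) R2r.
have [n3 n3P] := blocks_large 0.
exists (maxn n1 (maxn n2 n3)), cs; split.
  move=> n; rewrite !geq_max => /and3P[/n1P n1n /n2P n2n /n3P[kb0 _]].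
  have [pok K1n K2n _] := csP n kb0.
  split => //; first by apply: n1n; rewrite -mulrA [r * _]mulrC.
  by apply: n2n; rewrite -mulrA [r * _]mulrC.
move=> eps eps0; set nJ : R := #|{: J1 + J2}|%:R.
have [N0 N0P] := blocks_large (3 * nJ / (eps * m)).
exists N0 => n /N0P[kb0 kbC].
have [_ _ _ err] := csP n kb0; apply: le_trans err _; rewrite lee_fin -/nJ -/E1 -/E2.
set k : R := (n %/ eta)%:R in kbC *.
have k0 : 0 <= k by [].
have le_exp E : m <= E -> expR (- (k * E)) <= (1 + k * m)^-1.
  move=> mE; rewrite expRN lef_pV2 ?posrE ?expR_gt0//; last first.
    by rewrite ltr_pwDl// mulr_ge0// ltW.
  by apply: le_trans (expR_ge1Dx _); rewrite lerD2l ler_wpM2l.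
have := le_exp E1; rewrite /m ge_min lexx -/m => /(_ isT) e1.
have := le_exp E2; rewrite /m ge_min lexx orbT -/m => /(_ isT) e2.
have km : 0 < 1 + k * m by rewrite ltr_pwDl// mulr_ge0// ltW.
apply: (@le_trans _ _ (nJ * (3 * (1 + k * m)^-1))).
  by rewrite ler_wpM2l//; lra.
rewrite mulrA ler_pdivrMr//.
move: kbC; rewrite ltr_pdivrMr ?mulr_gt0// => kbC.
by lra.
Qed.

End Achievability.

(** * Covering the pentagon of rates *)

Section RateRegion.
Variable R : realType.

Lemma cov_det11_ge1 (p1 p2 g : R) : 0 <= p1 -> 0 <= p2 -> g ^+ 2 <= p1 * p2 ->
  1 <= cov_det p1 p2 g 1 1.
Proof. by rewrite /cov_det => *; lra. Qed.

(* On the dominant face, [v0] is the fraction of user 2 left undecoded when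
   user 1 is decoded. *)
Lemma exists_split (p1 p2 g x1 x2 : R) : 0 <= p1 -> 0 <= p2 -> g ^+ 2 <= p1 * p2 ->
  x1 <= ln (1 + p1) -> x2 <= ln (1 + p2) -> x1 + x2 <= ln (cov_det p1 p2 g 1 1) ->
  exists v0, [/\ 0 <= v0 <= 1,
    x1 <= ln (cov_det p1 p2 g 1 v0 / cov_det p1 p2 g 0 v0) &
    x2 <= ln (cov_det p1 p2 g 1 1 / cov_det p1 p2 g 1 v0) + ln (cov_det p1 p2 g 0 v0)].
Proof.
move=> p10 p20 cau h1 h2 h12.
have D1 := cov_det11_ge1 p10 p20 cau.
set D := cov_det p1 p2 g 1 1 in D1 h12 *.
have D0 : 0 < D by exact: lt_le_trans D1.
have c0 v : cov_det p1 p2 g 0 v = 1 + v * p2 by rewrite /cov_det; ring.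
have P1 : 0 < 1 + p1 by lra.
have P2 : 0 < 1 + p2 by lra.
have [xD|xD] := leP (expR x1) (D / (1 + p2)).
  (* User 1 can be decoded entirely while all of user 2 is interference, after which user 2 sees no
     interference. *)
  exists 1; split; first by rewrite ler01 lexx.
    by rewrite c0 mul1r -/D -ler_expR lnK// posrE divr_gt0.
  by rewrite c0 mul1r -/D divff ?gt_eqF// ln1 add0r.
set x := expR x1 in xD; have x0 : 0 < x by exact: expR_gt0.
have xp : x <= 1 + p1 by rewrite /x -[leRHS]lnK ?posrE// ler_expR.
(* Here [v0] is the root of [cov_det p1 p2 g 1 v0 = x * (1 + v0 * p2)], a linear equation: user 1
   then gets exactly [x1]. The failure of the first case is what puts the root below 1. *)
pose y := 1 + p1 - x.
have y0 : 0 <= y by rewrite subr_ge0.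
have yg : y * (1 + p2) < g ^+ 2.
  by move: xD; rewrite ltr_pdivrMr// /y /D /cov_det; lra.
pose den := g ^+ 2 - y * p2.
have yden : y < den by rewrite /den; lra.
have den0 : 0 < den by exact: le_lt_trans yden.
pose v0 := y / den.
have v00 : 0 <= v0 by rewrite divr_ge0// ltW.
have v01 : v0 <= 1 by rewrite ler_pdivrMr// mul1r ltW.
have vE : v0 * den = y by rewrite divfK// gt_eqF.
have C0 : 0 < 1 + v0 * p2 by rewrite ltr_pwDl// mulr_ge0.
have c1 : cov_det p1 p2 g 1 v0 = x * (1 + v0 * p2).
  by move: vE; rewrite /den /cov_det /y; lra.
exists v0; split; first by rewrite v00.
  by rewrite c1 c0 mulfK ?gt_eqF// /x expRK.
rewrite c1 c0 ln_div ?posrE ?mulr_gt0// lnM ?posrE// /x expRK.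
by lra.
Qed.

(** Two losses have order [vs]: the two wasted layers cost 2 vs, and (1 + vs)^2 <= 1 + 3 vs costs at
    most 6 e r vs. Together they must stay below 2 e delta. *)
Lemma final_rate (e M r delta vs : R) : 0 < e -> 0 <= M -> 0 <= r -> 0 < vs -> vs <= 1 ->
  vs * (1 + 3 * e * r) < e * delta -> 2 * e * r <= (M + 2) * vs ->
  r - delta < M * (vs / (2 * (1 + vs) ^+ 2)) / e.
Proof.
move=> e0 M0 r0 vs0 vs1 small rM.
have w0 : 0 < 2 * (1 + vs) ^+ 2 by rewrite mulr_gt0// exprn_gt0//; lra.
rewrite ltr_pdivlMr// mulrA ltr_pdivlMr//.
have [d0|d0] := leP (r - delta) 0.
  apply: (@le_lt_trans _ _ (2 * e * (r - delta))).
    have -> : (r - delta) * e * (2 * (1 + vs) ^+ 2) = (2 * e * (r - delta)) * (1 + vs) ^+ 2.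
      by ring.
    have A0 : 2 * e * (r - delta) <= 0 by rewrite mulr_ge0_le0// mulr_ge0// ltW.
    have B1 : 0 <= (1 + vs) ^+ 2 - 1 by nra.
    by have := mulr_le0_ge0 A0 B1; lra.
  have : 0 <= vs * (3 * e * r) by rewrite !mulr_ge0// ltW.
  by lra.
have sq : (1 + vs) ^+ 2 <= 1 + 3 * vs by nra.
apply: (@le_lt_trans _ _ (2 * e * (r - delta) * (1 + 3 * vs))).
  have -> : (r - delta) * e * (2 * (1 + vs) ^+ 2) = (2 * e * (r - delta)) * (1 + vs) ^+ 2.
    by ring.
  by rewrite ler_wpM2l// !mulr_ge0// ?(ltW e0)// ltW.
have d1 : 0 < delta.
  have : 0 < e * delta by apply: lt_trans small; rewrite mulr_gt0// ltr_pwDl// !mulr_ge0// ltW.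
  by rewrite pmulr_rgt0.
have : 0 <= e * vs * delta by rewrite !mulr_ge0// ltW.
by lra.
Qed.

End RateRegion.

(** * Achievability of the region and of its closure *)

Section MainTheorem.
Variables (R : realType) (P1 P2 N s1 s2 rho : R).
Hypotheses (P1_gt0 : 0 < P1) (P2_gt0 : 0 < P2) (N_gt0 : 0 < N) (rho1 : -1 <= rho <= 1).

Lemma region_D_achievable (eta k : nat) (a1 a2 : 'cV[R]_eta) (B1 B2 : 'M[R]_eta)
    (D : 'M[R]_(k, eta)) r :
  (0 < eta)%N -> strictly_lower B1 -> strictly_lower B2 ->
  power_params P1 P2 N s1 s2 rho a1 a2 B1 B2 -> \det (D *m D^T) != 0 ->
  region_D N a1 a2 D r -> achievable P1 P2 N s1 s2 rho r.1 r.2.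
Proof.
move=> eta0 sl1 sl2 pw DD [r10 r20 h1 h2 h12] delta delta0.
have Nn := lt0r_neq0 N_gt0.
have e0 : 0 < eta%:R :> R by rewrite ltr0n.
pose f1 := rowproj D *m a1; pose f2 := rowproj D *m a2.
pose p1 := N^-1 * dotv f1 a1; pose p2 := N^-1 * dotv f2 a2; pose g := N^-1 * dotv f1 a2.
have fa11 : dotv f1 a1 = N * p1 by rewrite mulVKf.
have fa12 : dotv f1 a2 = N * g by rewrite mulVKf.
have fa22 : dotv f2 a2 = N * p2 by rewrite mulVKf.
have fa21 : dotv f2 a1 = N * g by rewrite -fa12 -(dotv_projr DD a2 a1) dotvC dotv_projr.
have ff11 : dotv f1 f1 = N * p1 by rewrite dotv_projr.
have ff12 : dotv f1 f2 = N * g by rewrite dotv_projr.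
have ff22 : dotv f2 f2 = N * p2 by rewrite dotv_projr.
have p10 : 0 <= p1 by rewrite -(pmulr_rge0 _ N_gt0) -ff11 dotv_ge0.
have p20 : 0 <= p2 by rewrite -(pmulr_rge0 _ N_gt0) -ff22 dotv_ge0.
have cau : g ^+ 2 <= p1 * p2.
  have := dotv_cauchy f1 f2; rewrite ff11 ff12 ff22 exprMn.
  by rewrite (_ : N * p1 * (N * p2) = N ^+ 2 * (p1 * p2)) ?ler_pM2l ?exprn_gt0//; ring.
rewrite rate_bound1// -/f1 -/p1 in h1; rewrite rate_bound1// -/f2 -/p2 in h2.
rewrite rate_bound2// -/f1 -/f2 -/p1 -/p2 -/g in h12.
have e2 : 0 < 2 * eta%:R :> R by rewrite mulr_gt0.
rewrite mulrC ler_pdivlMr// in h1; rewrite mulrC ler_pdivlMr// in h2.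
rewrite mulrC ler_pdivlMr// mulrDl in h12.
rewrite (_ : _ * _ - _ = cov_det p1 p2 g 1 1) in h12; last by rewrite /cov_det; ring.
have [v0 [v0i x1v x2v]] := exists_split p10 p20 cau h1 h2 h12.
(* The sum of the rates serves both users at once, and the factor 2 makes the inequality required by
   [final_rate] strict. *)
pose B : R := 2 * (1 + 3 * eta%:R * (r.1 + r.2)).
have B0 : 0 < B by rewrite mulr_gt0// ltr_pwDl// !mulr_ge0// ?addr_ge0// ltW.
pose vs := Num.min 1 (eta%:R * delta / B).
have vs0 : 0 < vs by rewrite lt_min ltr01 /= divr_gt0// mulr_gt0.
have vs1 : vs <= 1 by rewrite ge_min lexx.
have vsB : vs * B <= eta%:R * delta by rewrite -ler_pdivlMr// ge_min lexx orbT.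
have [J1 [J2 [rk [amp [h [[rki gs gl am1 am2] [l1 l2]]]]]]] :=
  exists_layers N_gt0 p10 p20 cau v0i vs0 ff11 ff12 ff22 fa11 fa12 fa21 fa22.
have small x : 0 <= x -> x <= r.1 + r.2 -> vs * (1 + 3 * eta%:R * x) < eta%:R * delta.
  move=> x0 xr; apply: lt_le_trans vsB; rewrite ltr_pM2l// /B.
  have : eta%:R * x <= eta%:R * (r.1 + r.2) by rewrite ler_wpM2l// ltW.
  have : 0 <= eta%:R * x by rewrite mulr_ge0// ltW.
  by lra.
(* The extra factor 1 + vs puts the layer rate strictly below vs / (2 (1 + vs)) and alters it only
   to second order. *)
have rate0 : 0 <= vs / (2 * (1 + vs) ^+ 2).
  by rewrite divr_ge0 ?(ltW vs0)// mulr_ge0// sqr_ge0.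
have rate1 : vs / (2 * (1 + vs) ^+ 2) < vs / (2 * (1 + vs)).
  have v1 : 0 < 1 + vs by lra.
  rewrite ltr_pM2l// ltf_pV2 ?posrE ?mulr_gt0 ?exprn_gt0// ltr_pM2l// expr2.
  by rewrite ltr_pMr//; lra.
apply: (layered_achievable P1_gt0 P2_gt0 N_gt0 rho1 eta0 sl1 sl2 pw rki gs gl am1 am2
  vs0 rate0 rate1).
  apply: final_rate => //; first by apply: small => //; lra.
  by apply: le_trans l1; rewrite mulrC.
apply: final_rate => //; first by apply: small => //; lra.
by apply: le_trans l2; rewrite mulrC.
Qed.

Lemma region_params_achievable (eta : nat) (a1 a2 : 'cV[R]_eta) (B1 B2 : 'M[R]_eta)
    (C : 'M[R]_(2, eta)) r :
  (0 < eta)%N -> strictly_lower B1 -> strictly_lower B2 ->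
  power_params P1 P2 N s1 s2 rho a1 a2 B1 B2 ->
  region_params N a1 a2 C r -> achievable P1 P2 N s1 s2 rho r.1 r.2.
Proof.
move=> eta0 sl1 sl2 pw; rewrite /region_params; case: ifPn => [_ ->|C0].
  (* With no rows all determinants are 1 and all rate bounds are 0, so the pair (0, 0) is an
     instance of the general case. *)
  apply: (@region_D_achievable eta 0 a1 a2 B1 B2 0) => //; first by rewrite det_mx00 oner_neq0.
  by split; rewrite //= /rate_bound !det_mx00 divr1 ln1 mulr0 ?addr0.
case: ifPn => [DD rD|_]; first exact: (region_D_achievable eta0 sl1 sl2 pw DD rD).
move=> [i [rowi rD]]; apply: (region_D_achievable eta0 sl1 sl2 pw _ rD).
rewrite det_mx11 mxE; under eq_bigr do rewrite [_^T _ _]mxE -expr2.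
apply: contra rowi => /eqP/psumr_eq0P H; apply/eqP/rowP => j.
have /eqP := H (fun l _ => sqr_ge0 (row i C 0 l)) j isT.
by rewrite sqrf_eq0 => /eqP ->; rewrite [RHS]mxE.
Qed.

End MainTheorem.

(* K_W = [[s1^2, rho s1 s2]; [rho s1 s2, s2^2]] ranges over all 2x2 PSD
   matrices as s1, s2 >= 0 and -1 <= rho <= 1. *)
Theorem mainTheorem16 (R : realType) (P1 P2 N s1 s2 rho : R) :
  0 < P1 -> 0 < P2 -> 0 < N ->
  0 <= s1 -> 0 <= s2 -> -1 <= rho <= 1 ->
  R_SI P1 P2 N s1 s2 rho `<=` C_NoisyFBSI P1 P2 N s1 s2 rho.
Proof.
move=> P10 P20 N0 _ _ rho1 r cl delta delta0.
(* The slack in the definition of achievability absorbs the closure: half of it for the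
   approximating pair, half for its codes. *)
have d2 : 0 < delta / 2 by rewrite divr_gt0.
have [r' [[eta [a1 [a2 [B1 [B2 [C [eta0 sl1 sl2 pw reg]]]]]]] [b1 b2]]] :=
  cl _ (nbhsx_ballx r (delta / 2) d2).
have [n0 [cs [rates err]]] :=
  region_params_achievable P10 P20 N0 rho1 eta0 sl1 sl2 pw reg d2.
have lt1 : r.1 - delta < r'.1 - delta / 2.
  by move: b1; rewrite /ball /= ltr_norml => /andP[_]; lra.
have lt2 : r.2 - delta < r'.2 - delta / 2.
  by move: b2; rewrite /ball /= ltr_norml => /andP[_]; lra.
exists n0, cs; split => // n /rates[pok K1n K2n].
by split => //; [exact: lt_trans K1n|exact: lt_trans K2n].
Qed.
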